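(* Let $\mathcal X$ be a projective, geometrically irreducible, nonsingular curve of genus $g$ over $\mathbf F_q$. Let $D=P_1+\dots+P_n$ be a sum of $n$ pairwise distinct $\mathbf F_q$-rational points of $\mathcal X$, and let $G$ be an $\mathbf F_q$-rational divisor with $P_i\notin\operatorname{supp}(G)$ for all $i$. Let $\mathcal C=\mathcal C(\mathcal X,D,G)$ have dimension $k$, and assume $2k\le n$ and $n>2g$. Let $\gamma_2$ be the gonality of $\mathcal X$ over $\mathbf F_q$. Then $$s[\mathcal C]\ge w(\mathcal C)-g+\gamma_2-2.$$
   Context: $\ell(F)=\dim_{\mathbf F_q}\mathcal L(F)$, where $\mathcal L(F)$ is the space of rational functions $f$ over $\mathbf F_q$ with $f=0$ or $F+\operatorname{div}(f)\succeq0$. The code $\mathcal C(\mathcal X,D,G)$ is the image of $\mathcal L(G)\to\mathbf F_q^n$, $f\mapsto(f(P_1),\dots,f(P_n))$. The gonality over $\mathbf F_q$ is $\gamma_2=\min\{\deg A: A\ \mathbf F_q\text{-rational divisor},\ \ell(A)\ge2\}$. For a linear $[n,k]$ code $\mathcal C$ with fixed coordinate order, define $\mathcal P_0=\mathcal F_n=0$, $\mathcal P_n=\mathcal F_0=\mathcal C$, and for $1\le i\le n-1$, $\mathcal P_i=\{(c_1,\dots,c_i):(c_1,\dots,c_i,0,\dots,0)\in\mathcal C\}$ and $\mathcal F_i=\{(c_{i+1},\dots,c_n):(0,\dots,0,c_{i+1},\dots,c_n)\in\mathcal C\}$. Put $\Delta_i=\dim\mathcal P_i+\dim\mathcal F_i$.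 The state complexity (of the minimal trellis) is $s(\mathcal C)=k-\min_{0\le i\le n}\Delta_i$. Further, $s[\mathcal C]$ is the minimum of $s(\mathcal C')$ over all codes $\mathcal C'$ obtained from $\mathcal C$ by permuting coordinates, and $w(\mathcal C)=\min\{k,n-k\}$. *)

(* Defs.v *)
From HB Require Import structures.
From mathcomp Require Import all_boot all_order all_algebra all_fingroup.
From mathcomp Require Import boolp classical_sets.
Set Implicit Arguments. Unset Strict Implicit. Unset Printing Implicit Defensive.
Import Order.TTheory GRing.Theory Num.Theory.
Local Open Scope ring_scope.

(* A projective, geometrically irreducible, nonsingular curve X/F_q   *)
(* is represented by its function field K = F_q(X) (with F_q as full  *)
(* constant field); closed points of X <-> places of K/F_q, F_q-      *)
(* rational points <-> places of degree 1 (Stichtenoth, Ch. 1).       *)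
Section FunctionField.
Variables (F : finFieldType) (K : fieldType) (iota : {rmorphism F -> K}).

Definition ev_poly (p : {poly F}) (x : K) : K := (map_poly iota p).[x].

Definition transcendental (x : K) : Prop :=
  forall p : {poly F}, p != 0 -> ev_poly p x != 0.

Definition algebraic (y : K) : Prop :=
  exists2 p : {poly F}, p != 0 & ev_poly p y = 0.

(* K is a finite extension of the rational function field F(x), for some *)
(* x transcendental over F: an algebraic function field of one variable.  *)
Definition function_field : Prop :=
  exists x : K, transcendental x /\
    exists (m : nat) (b : 'I_m -> K), forall y : K,
      exists (q : {poly F}) (p : 'I_m -> {poly F}),
        q != 0 /\ ev_poly q x * y = \sum_(i < m) ev_poly (p i) x * b i.

(* F is algebraically closed in K (full constant field; equivalent to     *)
(* geometric irreducibility since F is perfect).                          *)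
Definition full_constant_field : Prop :=
  forall y : K, algebraic y -> exists c : F, y = iota c.

(* The value at 0 is conventionally fixed to 0 (it plays no role).        *)
Definition is_place (v : K -> int) : Prop :=
  [/\ v 0 = 0,
      forall x y, x != 0 -> y != 0 -> v (x * y) = v x + v y,
      forall x y, x != 0 -> y != 0 -> x + y != 0 -> Num.min (v x) (v y) <= v (x + y),
      forall c : F, c != 0 -> v (iota c) = 0
    & exists t : K, t != 0 /\ v t = 1].

Record place := Place { pval :> K -> int ; pvalP : is_place pval }.
HB.instance Definition _ := gen_eqMixin place.
HB.instance Definition _ := gen_choiceMixin place.

Definition vge (P : place) (x : K) (m : int) : Prop := x = 0 \/ m <= P x.

(* Degree of a place = dimension over F of the residue field O_P / P.     *)
Definition deg_is (P : place) (d : nat) : Prop :=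
  exists b : 'I_d -> K,
    [/\ forall i, vge P (b i) 0,
        forall c : 'I_d -> F,
          vge P (\sum_(i < d) iota (c i) * b i) 1 -> forall i, c i = 0
      & forall x, vge P x 0 ->
          exists c : 'I_d -> F, vge P (x - \sum_(i < d) iota (c i) * b i) 1].

Definition pdeg (P : place) : nat := xget 0%N [set d | deg_is P d].

Definition divisor := seq (place * int).

Definition coef (A : divisor) (P : place) : int :=
  \sum_(x <- A | x.1 == P) x.2.

Definition ddeg (A : divisor) : int :=
  \sum_(x <- A) x.2 * (pdeg x.1)%:Z.

Definition inL (A : divisor) (f : K) : Prop :=
  forall P : place, vge P f (- coef A P).

Definition ell_is (A : divisor) (m : nat) : Prop :=
  exists b : 'I_m -> K,
    [/\ forall i, inL A (b i),
        forall c : 'I_m -> F,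
          \sum_(i < m) iota (c i) * b i = 0 -> forall i, c i = 0
      & forall f, inL A f ->
          exists c : 'I_m -> F, f = \sum_(i < m) iota (c i) * b i].

Definition ell (A : divisor) : nat := xget 0%N [set m | ell_is A m].

(* genus g = max { deg A - l(A) + 1 : A divisor }  (Stichtenoth 1.4.15) *)
Definition is_genus (g : nat) : Prop :=
  (forall A : divisor, ddeg A - (ell A)%:Z + 1 <= g%:Z) /\
  (exists A : divisor, ddeg A - (ell A)%:Z + 1 = g%:Z).

Definition is_gonality (gam : int) : Prop :=
  (exists A : divisor, (2 <= ell A)%N /\ ddeg A = gam) /\
  (forall A : divisor, (2 <= ell A)%N -> gam <= ddeg A).

End FunctionField.

Section Trellis.
Variables (F : fieldType) (n : nat).

Definition coordsub (S : pred 'I_n) : {vspace 'rV[F]_n} :=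
  <<[seq delta_mx (ord0 : 'I_1) j | j <- enum S]>>%VS.

(* dim P_i + dim F_i : P_i = codewords vanishing on coordinates i+1..n    *)
(* (1-indexed), F_i = codewords vanishing on coordinates 1..i.            *)
Definition Delta (C : {vspace 'rV[F]_n}) (i : nat) : nat :=
  (\dim (C :&: coordsub (fun j : 'I_n => (j < i)%N)) +
   \dim (C :&: coordsub (fun j : 'I_n => (i <= j)%N)))%N.

Definition state_cx (C : {vspace 'rV[F]_n}) : nat :=
  (\dim C - \big[minn/(\dim C)]_(i < n.+1) Delta C i)%N.

Definition permcode (s : 'S_n) (C : {vspace 'rV[F]_n}) : {vspace 'rV[F]_n} :=
  (linfun (mulmxr (perm_mx s)) @: C)%VS.

Definition perm_state_cx (C : {vspace 'rV[F]_n}) : nat :=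
  \big[minn/(state_cx C)]_(s : 'S_n) state_cx (permcode s C).

Definition wcode (C : {vspace 'rV[F]_n}) : nat := minn (\dim C) (n - \dim C).

End Trellis.

(* Main.v *)
Require Import Defs.
From HB Require Import structures.
From mathcomp Require Import all_boot all_order all_algebra all_fingroup.
From mathcomp Require Import boolp classical_sets functions.
From mathcomp Require Import zify.
Set Implicit Arguments. Unset Strict Implicit. Unset Printing Implicit Defensive.
Import Order.TTheory GRing.Theory Num.Theory.
Local Open Scope ring_scope.

(** For every ordering of the points some cut point i satisfies
    [dim P_i + dim F_i <= l(A) + l(B)] with [A], [B] obtained from [G] by removing
    the points after, respectively before, the cut.  As [dim C <= n/2] and [n > 2g],
    Riemann's inequality forces [deg G < n] and [deg A + deg B <= 2g - 2].  Take the
    first cut with [l(B) <= 1]: one step earlier [l >= 2], so [deg B >= gamma2 - 1]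
    and [deg A <= 2g - 1 - gamma2].  A divisor of degree [2g - 1 - gamma2] with index
    of speciality at least 2 would carry two independent Weil differentials, whose
    quotient, together with 1, lies in [L(W - A)] for a divisor [W] of degree at most
    [2g - 2]; this contradicts the gonality.  Hence [l(A) <= g + 1 - gamma2].

    The dimension facts about [L(A)] are drawn from the definition of the genus,
    which contains Riemann's inequality: finiteness of [l(A)], [l(0) = 1], and
    [l(A) = 0] in negative degree. *)

(** * Dimension of a subspace modulo another *)

Section RelativeDimension.
Variables (F : fieldType) (V : lmodType F).
Implicit Types S T U : V -> Prop.

Definition subsp S := S 0 /\ forall a x y, S x -> S y -> S (a *: x + y).

Definition indep T (I : finType) (b : I -> V) :=
  forall c : I -> F, T (\sum_i c i *: b i) -> forall i, c i = 0.

Definition spans S T (I : finType) (b : I -> V) :=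
  forall x, S x -> exists c : I -> F, T (x - \sum_i c i *: b i).

(** The dimension of S/(S ∩ T), expressed through representatives: [K] and the adeles are
    infinite-dimensional over [F], and the finite dimensions in play belong to subquotients. *)
Definition rdim S T n := exists b : 'I_n -> V,
  [/\ forall i, S (b i), indep T b & spans S T b].

Lemma subsp0 S : subsp S -> S 0. Proof. by case. Qed.

Lemma subspZ S a x : subsp S -> S x -> S (a *: x).
Proof. by move=> [S0 SL] Sx; rewrite -[_ *: _]addr0; apply: SL. Qed.

Lemma subspD S x y : subsp S -> S x -> S y -> S (x + y).
Proof. by move=> [S0 SL] Sx Sy; rewrite -[x]scale1r; apply: SL. Qed.

Lemma subspN S x : subsp S -> S x -> S (- x).
Proof. by move=> sS Sx; rewrite -scaleN1r; apply: subspZ. Qed.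

Lemma subspB S x y : subsp S -> S x -> S y -> S (x - y).
Proof. by move=> sS Sx Sy; apply: subspD => //; apply: subspN. Qed.

Lemma subsp_sum S (I : Type) (r : seq I) (P : pred I) (f : I -> V) :
  subsp S -> (forall i, P i -> S (f i)) -> S (\sum_(i <- r | P i) f i).
Proof.
by move=> sS Sf; apply: big_ind => //; [exact: subsp0 | move=> *; apply: subspD].
Qed.

Lemma subsp_lin S (I : finType) (c : I -> F) (f : I -> V) :
  subsp S -> (forall i, S (f i)) -> S (\sum_i c i *: f i).
Proof. by move=> sS Sf; apply: subsp_sum => // i _; apply: subspZ. Qed.

Lemma subsp_zero : subsp (fun x => x = 0).
Proof. by split=> // a x y -> ->; rewrite scaler0 addr0. Qed.

Lemma subsp_add S T : subsp S -> subsp T ->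
  subsp (fun x => exists2 y, S y & T (x - y)).
Proof.
move=> sS sT; split; first by exists 0; rewrite ?subrr; exact: subsp0.
move=> a x y [u Su Tu] [v Sv Tv]; exists (a *: u + v); first exact: sS.2.
have -> : a *: x + y - (a *: u + v) = a *: (x - u) + (y - v).
  by rewrite scalerBr opprD addrACA.
exact: sT.2.
Qed.

(** If the claim fails, the coordinates of the [u j] modulo [T] form a matrix with more rows than
    columns; a nonzero row vector killing it is a forbidden relation. *)
Lemma steinitz S T (I J : finType) (b : I -> V) (u : J -> V) : subsp T ->
  spans S T b -> (forall j, S (u j)) -> indep T u -> (#|J| <= #|I|)%N.
Proof.
move=> sT sb Su iu; rewrite leqNgt; apply/negP => ltIJ.
have /choice[m mP] : forall j, exists c : I -> F, T (u j - \sum_i c i *: b i).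
  by move=> j; apply: sb.
pose M := \matrix_(j < #|J|, i < #|I|) m (enum_val j) (enum_val i).
have : kermx M != 0.
  rewrite kermx_eq0 /row_free neq_ltn; apply/orP; left.
  exact: leq_ltn_trans (rank_leq_col M) ltIJ.
case/rowV0Pn => w /sub_kermxP wM /eqP; apply; apply/rowP => k; rewrite mxE.
have := iu (fun j => w 0 (enum_rank j)) _ (enum_val k); rewrite enum_valK; apply.
have -> : \sum_j w 0 (enum_rank j) *: u j =
          \sum_j w 0 (enum_rank j) *: (u j - \sum_i m j i *: b i).
  apply/eqP; rewrite -subr_eq0 -sumrB; apply/eqP.
  transitivity (\sum_j \sum_i (w 0 (enum_rank j) * m j i) *: b i).
    apply: eq_bigr => j _; rewrite -scalerBr subKr scaler_sumr.
    by apply: eq_bigr => i _; rewrite scalerA.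
  rewrite exchange_big big1 //= => i _; rewrite -scaler_suml.
  move/rowP/(_ (enum_rank i)): wM; rewrite !mxE.
  rewrite (reindex _ (onW_bij _ (@enum_rank_bij J))) /= => E.
  rewrite (eq_bigr (fun j => w 0 (enum_rank j) * M (enum_rank j) (enum_rank i))) ?E ?scale0r //.
  by move=> j _; rewrite mxE !enum_rankK.
exact: subsp_lin.
Qed.

Lemma rdim_indep S T n (J : finType) (u : J -> V) : subsp T -> rdim S T n ->
  (forall j, S (u j)) -> indep T u -> (#|J| <= n)%N.
Proof. by move=> sT [b [_ _ sb]] Su iu; have := steinitz sT sb Su iu; rewrite card_ord. Qed.

Lemma rdim_spans S T n (J : finType) (b : J -> V) : subsp T -> rdim S T n ->
  spans S T b -> (n <= #|J|)%N.
Proof. by move=> sT [u [Su iu _]] sb; have := steinitz sT sb Su iu; rewrite card_ord. Qed.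

Lemma rdim_uniq S T m n : subsp T -> rdim S T m -> rdim S T n -> m = n.
Proof.
move=> sT Sm [b [Sb ib sb]]; apply/eqP; rewrite eqn_leq.
have := rdim_spans sT Sm sb; have := rdim_indep sT Sm Sb ib.
by rewrite !card_ord => -> ->.
Qed.

Definition ord_rcons n (W : Type) (b : 'I_n -> W) (x : W) (i : 'I_n.+1) : W :=
  if unlift ord_max i is Some j then b j else x.

Lemma sum_ord_rcons n (b : 'I_n -> V) x (c : 'I_n.+1 -> F) :
  \sum_i c i *: ord_rcons b x i =
  \sum_i c (lift ord_max i) *: b i + c ord_max *: x.
Proof.
rewrite big_ord_recr /= /ord_rcons unlift_none; congr (_ + _).
apply: eq_bigr => i _.
have -> : widen_ord (leqnSn n) i = lift ord_max i.
  by apply: val_inj; rewrite /= /bump leqNgt ltn_ord.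
by rewrite liftK.
Qed.

Lemma maximal_indep_spans S T n (b : 'I_n -> V) :
  subsp S -> subsp T -> (forall i, S (b i)) -> indep T b ->
  (forall u : 'I_n.+1 -> V, (forall i, S (u i)) -> indep T u -> False) ->
  spans S T b.
Proof.
move=> sS sT Sb ib bmax x Sx; apply: contrapT => nx.
apply: (bmax (ord_rcons b x)).
  by move=> i; rewrite /ord_rcons; case: unliftP.
move=> c; rewrite sum_ord_rcons => Tc.
have c0 : c ord_max = 0.
  apply: contra_notP nx => /eqP c0.
  exists (fun i => - (c (lift ord_max i) / c ord_max)).
  suff -> : x - \sum_i - (c (lift ord_max i) / c ord_max) *: b i =
    (c ord_max)^-1 *: (\sum_i c (lift ord_max i) *: b i + c ord_max *: x) by apply: subspZ.
  rewrite scalerDr scalerA mulVf // scale1r addrC -sumrN scaler_sumr; congr (_ + _).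
  by apply: eq_bigr => i _; rewrite scaleNr opprK scalerA mulrC.
move: Tc; rewrite c0 scale0r addr0 => /ib cl i.
by case: (unliftP ord_max i) => [j ->|->]; [exact: cl | ].
Qed.

(** A uniform bound on independent families stands in for finite-dimensionality: an independent
    family of maximal size spans. *)
Lemma rdim_exists S T N : subsp S -> subsp T ->
  (forall n (u : 'I_n -> V), (forall i, S (u i)) -> indep T u -> (n <= N)%N) ->
  exists2 m, (m <= N)%N & rdim S T m.
Proof.
move=> sS sT bnd.
pose Q n := `[< exists u : 'I_n -> V, (forall i, S (u i)) /\ indep T u >].
have Q0 : exists n, Q n.
  exists 0%N; apply/asboolP; exists (fun _ => 0); split; first by case.
  by move=> c _ [].
have Qb n : Q n -> (n <= N)%N by move=> /asboolP [u [Su iu]]; exact: bnd iu.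
case: (ex_maxnP Q0 Qb) => m Qm mmax; exists m; first exact: Qb.
move/asboolP: Qm => [b [Sb ib]]; exists b; split=> //.
apply: maximal_indep_spans => // u Su iu.
have : (m.+1 <= m)%N by apply: mmax; apply/asboolP; exists u.
by rewrite ltnn.
Qed.

Lemma rdim_full S T n (b : 'I_n -> V) : subsp S -> subsp T -> rdim S T n ->
  (forall i, S (b i)) -> indep T b -> spans S T b.
Proof.
move=> sS sT Sn Sb ib; apply: maximal_indep_spans => // u Su iu.
by have := rdim_indep sT Sn Su iu; rewrite card_ord ltnn.
Qed.

Lemma rdim_sub S S' T n : subsp S' -> subsp T -> (forall x, S' x -> S x) ->
  rdim S T n -> exists2 m, (m <= n)%N & rdim S' T m.
Proof.
move=> sS' sT SS' Sn; apply: rdim_exists => // m u Su iu.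
by rewrite -[m]card_ord; apply: rdim_indep Sn _ iu => // i; apply: SS'.
Qed.

Lemma rdim_subT S T T' n : subsp S -> subsp T -> subsp T' ->
  (forall x, T x -> T' x) ->
  rdim S T n -> exists2 m, (m <= n)%N & rdim S T' m.
Proof.
move=> sS sT sT' TT' Sn; apply: rdim_exists => // m u Su iu.
rewrite -[m]card_ord; apply: rdim_indep Sn Su _ => // c Tc; apply: iu; exact: TT'.
Qed.

Lemma rdim_trans S T U m n : subsp S -> subsp T -> subsp U ->
  (forall x, U x -> T x) -> (forall x, T x -> S x) ->
  rdim S T m -> rdim T U n -> rdim S U (m + n).
Proof.
move=> sS sT sU UT TS [b [Sb ib sb]] [d [Td jd sd]].
pose e i := match fintype.split i with inl j => b j | inr k => d k end.
have sume (c : 'I_(m + n) -> F) : \sum_i c i *: e i =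
    \sum_j c (lshift n j) *: b j + \sum_k c (rshift m k) *: d k.
  rewrite big_split_ord /=; congr (_ + _); apply: eq_bigr => j _; rewrite /e.
    by rewrite (@fintype.unsplitK m n (inl j)).
  by rewrite (@fintype.unsplitK m n (inr j)).
exists e; split.
- by move=> i; rewrite /e; case: (fintype.split _) => j //; apply: TS.
- move=> c; rewrite sume => Uc.
  have cl : forall j, c (lshift n j) = 0.
    apply: ib; rewrite -[X in T X](addrK (\sum_k c (rshift m k) *: d k)).
    by apply: subspB => //; [apply: UT | apply: subsp_lin].
  have cr : forall k, c (rshift m k) = 0.
    apply: jd; move: Uc; rewrite big1 ?add0r // => j _.
    by rewrite cl scale0r.
  by move=> i; rewrite -(fintype.splitK i); case: (fintype.split _) => j; [exact: cl | exact: cr].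
- move=> x /sb[c Tc]; have [c' Uc] := sd _ Tc.
  exists (fun i => match fintype.split i with inl j => c j | inr k => c' k end).
  rewrite sume opprD addrA.
  rewrite (eq_bigr (fun j => c j *: b j)); last by move=> j _; rewrite (@fintype.unsplitK m n (inl j)).
  rewrite [X in _ - X](eq_bigr (fun j => c' j *: d j)) //.
  by move=> j _; rewrite (@fintype.unsplitK m n (inr j)).
Qed.

Lemma rdim_split S T U n : subsp S -> subsp T -> subsp U ->
  (forall x, U x -> T x) -> (forall x, T x -> S x) ->
  rdim S U n -> exists m p, [/\ rdim S T m, rdim T U p & (m + p = n)%N].
Proof.
move=> sS sT sU UT TS Sn.
have [m _ Sm] := rdim_subT sS sU sT UT Sn.
have [p _ Tp] := rdim_sub sT sU TS Sn.
exists m, p; split=> //; apply: rdim_uniq Sn => //; exact: rdim_trans Sm Tp.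
Qed.

End RelativeDimension.

Section Relation.
Variables (F : fieldType) (V W : lmodType F).

(* A relation rather than a map: reduction at the points of the code is only defined on
   part of K, and multiplication of functionals only agrees on adeles. *)
Lemma rdim_rel (S T : V -> Prop) (S' T' : W -> Prop) (R : V -> W -> Prop) m n :
  subsp T' -> R 0 0 ->
  (forall a x y x' y', R x x' -> R y y' -> R (a *: x + y) (a *: x' + y')) ->
  (forall x, S x -> exists2 y, S' y & R x y) ->
  (forall x y, R x y -> T' y -> T x) ->
  rdim S T m -> rdim S' T' n -> (m <= n)%N.
Proof.
move=> sT' R0 RL Rtot Rinj [b [Sb ib _]] S'n.
have /choice[u uP] : forall i, exists y, S' y /\ R (b i) y.
  by move=> i; have [y ? ?] := Rtot _ (Sb i); exists y.
rewrite -[m]card_ord; apply: (rdim_indep sT' S'n (u := u)).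
  by move=> i; case: (uP i).
move=> c Tc; apply: ib; apply: Rinj Tc.
apply: (big_ind2 R) => // [x x' y y' Rx Ry|i _].
  by rewrite -[x]scale1r -[x']scale1r; apply: RL.
by rewrite -[X in R X]addr0 -[X in R _ X]addr0; apply: RL => //; case: (uP i).
Qed.

End Relation.

(** * Functionals and the dual of a quotient *)

Section Dual.
Variables (F : fieldType) (V : lmodType F).
Implicit Types S T : V -> Prop.

Definition functional_on S (l : V -> F^o) :=
  forall a x y, S x -> S y -> l (a *: x + y) = a * l x + l y.

(** A functional is a total function constrained on [S] alone, so its zero class is
    [annihilator S S], and dimensions are taken modulo that. *)
Definition annihilator S T (l : V -> F^o) :=
  functional_on S l /\ forall x, T x -> l x = 0.

Lemma functional_on0 S l : subsp S -> functional_on S l -> l 0 = 0.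
Proof.
move=> sS lS; have := lS (-1) 0 0 (subsp0 sS) (subsp0 sS).
by rewrite scaler0 addr0 mulN1r addNr.
Qed.

Lemma functional_on_sum S l (I : finType) (c : I -> F) (b : I -> V) : subsp S ->
  functional_on S l -> (forall i, S (b i)) ->
  l (\sum_i c i *: b i) = \sum_i c i * l (b i).
Proof.
move=> sS lS Sb.
suff : S (\sum_i c i *: b i) /\ l (\sum_i c i *: b i) = \sum_i c i * l (b i) by case.
elim/big_rec2: _ => [|i y x _ [Sy <-]].
  by split; [exact: subsp0 | exact: functional_on0 lS].
by split; [apply: sS.2 | rewrite lS].
Qed.

Lemma functional_onB S l x y : functional_on S l -> S x -> S y ->
  l (x - y) = l x - l y.
Proof. by move=> lS Sx Sy; rewrite addrC -scaleN1r lS // mulN1r addrC. Qed.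

Lemma subsp_annihilator S T : subsp (annihilator S T).
Proof.
split.
  have z x : (0 : V -> F^o) x = 0 by [].
  by split=> [a x y _ _|//]; rewrite !z mulr0 addr0.
move=> a l l' [lS lT] [l'S l'T].
have z x : (a *: l + l') x = a * l x + l' x by [].
split; last by move=> x Tx; rewrite z lT // l'T // mulr0 addr0.
by move=> c x y Sx Sy; rewrite !z lS // l'S // !mulrDr addrACA !mulrA [a * c]mulrC.
Qed.

(** The coordinates [co] modulo [T] form the dual basis; off [S] their values are arbitrary. *)
Lemma rdim_dual S T n : subsp S -> subsp T -> (forall x, T x -> S x) ->
  rdim S T n -> rdim (annihilator S T) (annihilator S S) n.
Proof.
move=> sS sT TS [b [Sb ib sb]].
have /choice[co coP] : forall x, exists c : 'I_n -> F,
    S x -> T (x - \sum_i c i *: b i).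
  by move=> x; case: (pselect (S x)) => [/sb[c ?]|nS]; [exists c | exists (fun _ => 0)].
have co_uniq x c : S x -> T (x - \sum_i c i *: b i) -> forall i, co x i = c i.
  move=> Sx Tx i; apply/eqP; rewrite -subr_eq0; apply/eqP.
  apply: (ib (fun i => co x i - c i)).
  have -> : \sum_i (co x i - c i) *: b i =
     (x - \sum_i c i *: b i) - (x - \sum_i co x i *: b i).
    rewrite opprB addrC addrA subrK -sumrB.
    by apply: eq_bigr => j _; rewrite scalerBl.
  by apply: subspB => //; apply: coP.
have coL i : functional_on S (fun x => co x i).
  move=> a x y Sx Sy; apply: (co_uniq _ (fun j => a * co x j + co y j)).
    exact: sS.2.
  have -> : a *: x + y - \sum_j (a * co x j + co y j) *: b j =
     a *: (x - \sum_j co x j *: b j) + (y - \sum_j co y j *: b j).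
    rewrite scalerBr addrACA -opprD scaler_sumr -big_split /=; congr (_ - _).
    by apply: eq_bigr => j _; rewrite scalerDl scalerA.
  by apply: sT.2; exact: coP.
have cob i j : co (b j) i = (i == j)%:R.
  apply: (co_uniq _ (fun i => (i == j)%:R)) => //.
  rewrite (bigD1 j) //= eqxx scale1r big1 ?addr0 ?subrr; first exact: subsp0.
  by move=> k /negPf ->; rewrite scale0r.
exists (fun i => (fun x => co x i) : V -> F^o); split.
- move=> i; split; first exact: coL.
  move=> x Tx; apply: (co_uniq _ (fun _ => 0)); first exact: TS.
  by rewrite big1 ?subr0 // => j _; rewrite scale0r.
- move=> c [_ c0] i; have := c0 (b i) (Sb i).
  rewrite fct_sumE (bigD1 i) //= big1 => [|k ki]; last first.
    by rewrite [LHS](_ : _ = c k * co (b i) k) // cob (negPf ki) mulr0.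
  by rewrite addr0 [X in X = _](_ : _ = c i * co (b i) i) // cob eqxx mulr1.
- move=> l [lS lT]; exists (fun i => l (b i)).
  have sumE x : (\sum_i l (b i) *: ((fun x => co x i) : V -> F^o)) x =
     l (\sum_i co x i *: b i).
    rewrite fct_sumE (functional_on_sum _ sS) //.
    by apply: eq_bigr => i _; rewrite mulrC.
  have SS x : S (\sum_i co x i *: b i) by exact: subsp_lin.
  have val0 x : S x -> (l - \sum_i l (b i) *: ((fun x => co x i) : V -> F^o)) x = 0.
    move=> Sx.
    transitivity (l x - l (\sum_i co x i *: b i)); first by rewrite -sumE.
    by rewrite -(functional_onB lS) //; apply: lT; apply: coP.
  split=> // a x y Sx Sy; rewrite !val0 ?mulr0 ?addr0 //; exact: sS.2.
Qed.

End Dual.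

(** * Places and finiteness of residue degrees *)

(* An alias of K, so that the F-module structure is determined by iota. *)
Definition Kmod (F : finFieldType) (K : fieldType) (iota : {rmorphism F -> K}) : Type := K.

Section KmodInstance.
Variables (F : finFieldType) (K : fieldType) (iota : {rmorphism F -> K}).

HB.instance Definition _ := GRing.Field.copy (Kmod iota) K.

Definition Kmod_scale (c : F) (x : Kmod iota) : Kmod iota := iota c * (x : K).

Fact Kmod_scaleA a b x : Kmod_scale a (Kmod_scale b x) = Kmod_scale (a * b) x.
Proof. by rewrite /Kmod_scale rmorphM mulrA. Qed.
Fact Kmod_scale1 : left_id 1 Kmod_scale.
Proof. by move=> x; rewrite /Kmod_scale rmorph1 mul1r. Qed.
Fact Kmod_scaleDr : right_distributive Kmod_scale +%R.
Proof. by move=> a x y; rewrite /Kmod_scale; exact: mulrDr. Qed.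
Fact Kmod_scaleDl v : {morph Kmod_scale^~ v : a b / a + b}.
Proof. by move=> a b; rewrite /Kmod_scale rmorphD; exact: mulrDl. Qed.

HB.instance Definition _ := GRing.Zmodule_isLmodule.Build F (Kmod iota)
  Kmod_scaleA Kmod_scale1 Kmod_scaleDr Kmod_scaleDl.

Lemma KmodZ (c : F) (x : Kmod iota) : c *: x = iota c * x :> K.
Proof. by []. Qed.

Lemma Kmod_mulZ (c : F) (x y : Kmod iota) : x * (c *: y) = c *: (x * y).
Proof. by rewrite !KmodZ; exact: mulrCA. Qed.

Lemma Kmod_Zmul (c : F) (x y : Kmod iota) : (c *: x) * y = c *: (x * y).
Proof. by rewrite !KmodZ; symmetry; exact: mulrA. Qed.

End KmodInstance.

Section Places.
Variables (F : finFieldType) (K : fieldType) (iota : {rmorphism F -> K}).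
Implicit Types (P Q : place iota) (x y : Kmod iota) (m n : int).

Lemma place_axioms P : is_place iota P. Proof. by case: P. Qed.

Lemma pvalM P x y : x != 0 -> y != 0 -> P (x * y) = P x + P y.
Proof. by case: (place_axioms P) => _ + _ _ _; apply. Qed.

Lemma val_const P (c : F) : c != 0 -> P (iota c) = 0.
Proof. by case: (place_axioms P) => _ _ _ + _; apply. Qed.

Lemma pval1 P : P 1 = 0.
Proof. by rewrite -(rmorph1 iota) val_const ?oner_neq0. Qed.

Lemma pvalV P x : x != 0 -> P x^-1 = - P x.
Proof.
move=> x0; apply/eqP; rewrite -addr_eq0 addrC -pvalM ?invr_eq0 //.
by rewrite mulfV // pval1.
Qed.

Lemma vge_neq0 P x m : x != 0 -> vge P x m -> m <= P x.
Proof. by move=> x0 [E|//]; rewrite E eqxx in x0. Qed.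

Lemma vge0 P m : vge P 0 m. Proof. by left. Qed.

Lemma vgeW P x m n : n <= m -> vge P x m -> vge P x n.
Proof. by move=> nm [|xm]; [left | right; exact: le_trans xm]. Qed.

Lemma vgeM P x y m n : vge P x m -> vge P y n -> vge P (x * y) (m + n).
Proof.
have [->|x0] := eqVneq x 0; first by rewrite mul0r; left.
have [->|y0] := eqVneq y 0; first by rewrite mulr0; left.
move=> /(vge_neq0 x0) xm /(vge_neq0 y0) yn.
by right; rewrite pvalM //; exact: lerD.
Qed.

Lemma vgeD P x y m : vge P x m -> vge P y m -> vge P (x + y) m.
Proof.
have [->|x0] := eqVneq x 0; first by rewrite add0r.
have [->|y0] := eqVneq y 0; first by rewrite addr0.
have [->|xy0] := eqVneq (x + y) 0; first by left.
move=> /(vge_neq0 x0) xm /(vge_neq0 y0) ym; right.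
case: (place_axioms P) => _ _ + _ _ => /(_ x y x0 y0 xy0); apply: le_trans.
by rewrite le_min xm.
Qed.

Lemma vge_const P (c : F) : vge P (iota c) 0.
Proof.
have [->|c0] := eqVneq c 0; first by rewrite rmorph0; left.
by right; rewrite val_const.
Qed.

Lemma vgeZ P (c : F) x m : vge P x m -> vge P (c *: x) m.
Proof. by move=> xm; have := vgeM (vge_const P c) xm; rewrite add0r. Qed.

Lemma subsp_vge P m : subsp (fun x : Kmod iota => vge P x m).
Proof.
by split=> [|a x y xm ym]; [left | apply: vgeD => //; exact: vgeZ].
Qed.

Lemma vgeN P x m : vge P x m -> vge P (- x) m.
Proof. by move=> xm; rewrite -scaleN1r; exact: vgeZ. Qed.

Lemma vge_sum P (I : finType) (B : pred I) (f : I -> Kmod iota) m :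
  (forall i, B i -> vge P (f i) m) -> vge P (\sum_(i | B i) f i) m.
Proof. exact: (@subsp_sum _ _ _ _ (index_enum I) B f (subsp_vge P m)). Qed.

Lemma vgeMr P x y m n : vge P (x * y) n -> y != 0 -> P y = m -> vge P x (n - m).
Proof.
move=> xyn y0 ym; rewrite -(mulfK y0 x) -ym -pvalV //.
by apply: vgeM => //; right.
Qed.

Lemma exists_val P m : exists2 s : K, s != 0 & P s = m.
Proof.
case: (place_axioms P) => _ _ _ _ [t [t0 vt]].
have pos k : exists2 s : K, s != 0 & P s = k%:Z.
  elim: k => [|k [s s0 IH]]; first by exists 1; [exact: oner_neq0 | exact: pval1].
  exists (s * t); first by rewrite mulf_neq0.
  by rewrite pvalM // IH vt -addn1 PoszD.
case: m => k; first exact: pos.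
have [s s0 sk] := pos k.+1.
by exists s^-1; rewrite ?invr_eq0 // pvalV // sk NegzE.
Qed.

Lemma deg_isE P d : deg_is P d <-> rdim (fun x : Kmod iota => vge P x 0) (fun x : Kmod iota => vge P x 1) d.
Proof. by split=> -[b [? ? ?]]; exists b; split. Qed.

Definition rr_space (A : divisor iota) : Kmod iota -> Prop := inL A.

Definition null : Kmod iota -> Prop := fun x => x = 0.

Lemma subsp_null : subsp null. Proof. exact: subsp_zero. Qed.

Lemma ell_isE (A : divisor iota) d : ell_is A d <-> rdim (rr_space A) null d.
Proof.
split=> -[b [? ? sb]]; exists b; split=> //.
  by move=> x /sb[c ->]; exists c; exact: subrr.
by move=> x /sb[c /eqP]; rewrite subr_eq0 => /eqP E; exists c.
Qed.

End Places.

(** * Boundedness of residue degrees *)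

Section ResidueDegree.
Variables (F : finFieldType) (K : fieldType) (iota : {rmorphism F -> K}).
Variables (x : K) (xtr : transcendental iota x) (m : nat) (b : 'I_m -> K).
Hypothesis bspan : forall y : K, exists (q : {poly F}) (p : 'I_m -> {poly F}),
  q != 0 /\ ev_poly iota q x * y = \sum_(i < m) ev_poly iota (p i) x * b i.

Let ev (p : {poly F}) : K := ev_poly iota p x.

Let evM p q : ev (p * q) = ev p * ev q.
Proof. by rewrite /ev /ev_poly rmorphM hornerM. Qed.
Let evD p q : ev (p + q) = ev p + ev q.
Proof. by rewrite /ev /ev_poly rmorphD hornerD. Qed.
Let ev0 : ev 0 = 0.
Proof. by rewrite /ev /ev_poly rmorph0 horner0. Qed.
Let evZ (c : F) p : ev (c *: p) = iota c * ev p.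
Proof. by rewrite /ev /ev_poly map_polyZ hornerZ. Qed.

(** [size] is the degree plus one, so step [d] allows coefficients of degree below [d] and is
    spanned by the [m d] elements [x^j b_i]. *)
Definition filtration d (y : Kmod iota) := exists2 p : 'I_m -> {poly F},
  forall i, (size (p i) <= d)%N & y = \sum_i ev (p i) * b i :> K.

Lemma subsp_filtration d : subsp (filtration d).
Proof.
split; first by exists (fun _ => 0) => [i|]; rewrite ?size_poly0 // big1 // => i _; rewrite ev0 mul0r.
move=> a y z [p sp ->] [q sq ->]; exists (fun i => a *: p i + q i) => [i|].
  apply: leq_trans (size_polyD _ _) _; rewrite geq_max sq andbT.
  by apply: leq_trans (sp i); exact: size_scale_leq.
rewrite KmodZ mulr_sumr -big_split /=; apply: eq_bigr => i _.
by rewrite evD evZ mulrDl mulrA.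
Qed.

Lemma filtrationW d e y : (d <= e)%N -> filtration d y -> filtration e y.
Proof. by move=> de [p sp ->]; exists p => // i; exact: leq_trans de. Qed.

Lemma filtration_poly d (q : {poly F}) (y : K) : filtration d y -> filtration (size q + d) (ev q * y).
Proof.
move=> [p sp ->]; exists (fun i => q * p i) => [i|].
  apply: leq_trans (size_polyMleq _ _) _; apply: leq_trans (leq_pred _) _.
  by rewrite leq_add2l.
by rewrite mulr_sumr; apply: eq_bigr => i _; rewrite evM mulrA.
Qed.

Lemma filtration_card d (J : finType) (w : J -> Kmod iota) :
  (forall j, filtration d (w j)) -> indep (@null F K iota) w -> (#|J| <= m * d)%N.
Proof.
move=> wd iw.
pose e (k : 'I_m * 'I_d) : Kmod iota := ev ('X^(k.2)) * b k.1.
have se : spans (filtration d) (@null F K iota) e.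
  move=> _ [p sp ->]; exists (fun k : 'I_m * 'I_d => (p k.1)`_(k.2)).
  apply/eqP; rewrite subr_eq0; apply/eqP.
  rewrite -(pair_bigA _ (fun (i : 'I_m) (j : 'I_d) => (p i)`_j *: e (i, j))) /=; apply: eq_bigr => i _.
  rewrite {1}/ev /ev_poly (@horner_coef_wide _ d) ?size_map_poly //.
  rewrite mulr_suml; apply: eq_bigr => j _.
  by rewrite coef_map KmodZ /e /ev /ev_poly map_polyXn hornerXn mulrA.
by have := steinitz (subsp_null iota) se wd iw; rewrite card_prod !card_ord.
Qed.

Lemma common_denominator n (y : 'I_n -> K) : exists (q : {poly F}) d,
  q != 0 /\ forall i, filtration d (ev q * y i).
Proof.
elim: n y => [|n IH] y; first by exists 1, 0%N; rewrite oner_neq0; split=> // -[].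
have [q [d [q0 qd]]] := IH (fun i => y (lift ord0 i)).
have [r [p [r0 rp]]] := bspan (y ord0).
pose e := \max_i size (p i).
exists (q * r), (size r + d + (size q + e))%N; split; first by rewrite mulf_neq0.
move=> i; case: (unliftP ord0 i) => [j ->|->].
  rewrite [q * r]mulrC evM -[X in filtration _ X]mulrA; apply: filtrationW (filtration_poly _ (qd j)).
  exact: leq_addr.
rewrite evM -[X in filtration _ X]mulrA; apply: (filtrationW (leq_addl _ _)).
apply: filtration_poly; exists p => // k; exact: leq_bigmax.
Qed.

(** A common denominator [q] of the [t b_i] serves all [y] at once, so the increase [c] does not
    depend on [d]. *)
Lemma multiplier_bound (t : K) : exists (q : {poly F}) c, q != 0 /\
  forall d y, filtration d y -> filtration (c + d) (ev q * (t * y)).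
Proof.
have [q [c [q0 qc]]] := common_denominator (fun i => t * b i).
exists q, c; split=> // d y [p sp ->].
rewrite !mulr_sumr; suff H i : filtration (c + d) (ev q * (t * (ev (p i) * b i))).
  exact: (@subsp_sum _ _ _ _ (index_enum _) xpredT _ (subsp_filtration (c + d)) (fun i _ => H i)).
rewrite [t * _]mulrCA [ev q * _]mulrCA.
apply: filtrationW (filtration_poly (p i) (qc i)).
by rewrite addnC leq_add2l.
Qed.

Lemma multiplier_bound_exp (t : K) : exists (q : {poly F}) c, q != 0 /\
  forall d y k i, (i <= k)%N -> filtration d y ->
    filtration (k * c + d) (ev q ^+ k * (t ^+ i * y)).
Proof.
have [q [c [q0 qc]]] := multiplier_bound t.
(* Each factor [q] raises the step by at most [e], whether it comes with a factor [t] or, once the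
   [t] are used up, alone. *)
pose e := maxn c (size q).
have qt d y : filtration d y -> filtration (e + d) (ev q * (t * y)).
  move=> /qc; apply: filtrationW; rewrite leq_add2r; exact: leq_maxl.
have qq d (y : K) : filtration d y -> filtration (e + d) (ev q * y).
  move=> /(filtration_poly q); apply: filtrationW; rewrite leq_add2r; exact: leq_maxr.
exists q, e; split=> // d y; elim=> [|k IH] i.
  by rewrite leqn0 => /eqP ->; rewrite !expr0 !mul1r.
rewrite leq_eqVlt => /orP[/eqP ->|ik] yd.
  rewrite mulSn -addnA.
  have -> : ev q ^+ k.+1 * (t ^+ k.+1 * y) = ev q * (t * (ev q ^+ k * (t ^+ k * y))).
    by rewrite !exprS -!mulrA; congr (_ * _); rewrite mulrCA.
  exact/qt/IH.
by rewrite mulSn -addnA exprS -mulrA; exact/qq/IH.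
Qed.

(** Write a relation as the sum of the [t^j y_j], with [y_j] a combination of the [u i]. Once the
    coefficients below level [s] vanish, [t^s y_s] has order at least [s + 1], so [y_s] has positive
    valuation and its coefficients vanish too. *)
Lemma uniformizer_indep (P : place iota) (t : K) (n k : nat) (u : 'I_n -> Kmod iota) :
  t != 0 -> P t = 1 -> (forall i, vge P (u i) 0) -> indep (fun y : Kmod iota => vge P y 1) u ->
  indep (@null F K iota) (fun ij : 'I_n * 'I_k => t ^+ ij.2 * u ij.1 : Kmod iota).
Proof.
move=> t0 t1 u0 iu c; rewrite /null.
pose y (j : 'I_k) : Kmod iota := \sum_i c (i, j) *: u i.
have tj (j : nat) : P (t ^+ j) = j%:Z.
  elim: j => [|j IH]; first by rewrite expr0 pval1.
  by rewrite exprS pvalM ?expf_neq0 // t1 IH -PoszD add1n.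
have -> : \sum_i c i *: (t ^+ i.2 * u i.1 : Kmod iota) = \sum_(j < k) (t ^+ j : Kmod iota) * y j.
  transitivity (\sum_(i < n) \sum_(j < k) c (i, j) *: (t ^+ j * u i : Kmod iota)).
    by rewrite pair_bigA; apply: eq_bigr => -[].
  rewrite exchange_big /=.
  apply: eq_bigr => j _; rewrite mulr_sumr; apply: eq_bigr => i _.
  by rewrite Kmod_mulZ.
have y0 j : vge P (y j) 0 := subsp_lin (fun i => c (i, j)) (subsp_vge P 0) u0.
move=> S0; suff cj : forall s (j : 'I_k), (j < s)%N -> forall i, c (i, j) = 0.
  by case=> i j; exact: (cj k j (ltn_ord j)).
elim=> // s IH j; rewrite ltnS leq_eqVlt => /orP[/eqP js|]; last exact: IH.
apply: iu => /=; rewrite -/(y j).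
suff : vge P ((t ^+ j : Kmod iota) * y j) s.+1.
  rewrite mulrC => /vgeMr/(_ (expf_neq0 _ t0) (tj j)).
  by rewrite js -addn1 PoszD addrC addKr.
move: S0; rewrite (bigD1 j) //= => /eqP; rewrite addr_eq0 => /eqP ->.
apply/vgeN/vge_sum => l lj.
have [ls|sl] := ltnP l s.
  by rewrite /y big1 ?mulr0 => [|i _]; [exact: vge0 | rewrite IH // scale0r].
have {}sl : (s < l)%N by rewrite ltn_neqAle sl andbT -js eq_sym.
rewrite -[X in vge _ _ X]addr0; apply: vgeM => //; right.
by rewrite [X in _ <= X]tj.
Qed.

(* For independent residues u_k (k < n) the n (N + 1) products u_k t^i with i <= N are
   independent over F and, up to a common denominator, lie in a step of the filtration of
   dimension m (c N + d) with c independent of n; hence n <= m c. *)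
Lemma residue_degree_bound (P : place iota) : exists N, forall n (u : 'I_n -> Kmod iota),
  (forall i, vge P (u i) 0) -> indep (fun y : Kmod iota => vge P y 1) u -> (n <= N)%N.
Proof.
have [t t0 t1] := exists_val P 1.
have [q [c [q0 qc]]] := multiplier_bound_exp t.
exists (m * c)%N => n u u0 iu.
have [r [d [r0 rd]]] := common_denominator u.
(* For this [N], the count n (N + 1) <= m (N c + d) = m c N + N rules out n > m c. *)
pose N := (m * d)%N.
have s0 : ev q ^+ N * ev r != 0 by rewrite mulf_neq0 ?expf_neq0 //; exact: xtr.
pose w (ij : 'I_n * 'I_N.+1) : Kmod iota := ev q ^+ N * (t ^+ ij.2 * (ev r * u ij.1)).
have wd ij : filtration (N * c + d) (w ij).
  by apply: qc; [rewrite -ltnS | exact: rd].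
have iw : indep (@null F K iota) w.
  move=> e; rewrite /null => e0.
  apply: (uniformizer_indep t0 t1 u0 iu (c := e)); rewrite /null.
  apply: (mulfI (s0 : (ev q ^+ N * ev r : Kmod iota) != 0)); rewrite mulr0 /= -[RHS]e0 mulr_sumr.
  apply: eq_bigr => ij _; rewrite Kmod_mulZ; congr (_ *: _).
  by rewrite /w -[LHS]mulrA; congr (_ * _); exact: mulrCA.
have := filtration_card wd iw; rewrite card_prod !card_ord /N; nia.
Qed.

End ResidueDegree.

Lemma pdegP (F : finFieldType) (K : fieldType) (iota : {rmorphism F -> K})
  (hff : function_field iota) (P : place iota) : 
  rdim (fun x : Kmod iota => vge P x 0) (fun x : Kmod iota => vge P x 1) (pdeg P).
Proof.
have [x [xtr [m [b bspan]]]] := hff.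
have [N bnd] := residue_degree_bound xtr bspan P.
have [d _ /deg_isE dP] := rdim_exists (subsp_vge P 0) (subsp_vge P 1) bnd.
by apply/deg_isE; rewrite /pdeg; apply: (@xgetI _ 0%N [set d | deg_is P d] d).
Qed.

Lemma pdeg_gt0 (F : finFieldType) (K : fieldType) (iota : {rmorphism F -> K})
  (hff : function_field iota) (P : place iota) : (0 < pdeg P)%N.
Proof.
have [b [_ _ sb]] := pdegP hff P.
have /sb[c] : vge P (1 : Kmod iota) 0 by right; rewrite pval1.
case: posnP b sb c => // -> b _ c; rewrite big_ord0 subr0.
by move/(vge_neq0 (oner_neq0 _)); rewrite pval1.
Qed.

Lemma residue_const (F : finFieldType) (K : fieldType) (iota : {rmorphism F -> K})
  (hff : function_field iota) (P : place iota) (x : Kmod iota) :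
  pdeg P = 1%N -> vge P x 0 -> exists c : F, vge P (x - iota c : Kmod iota) 1.
Proof.
have := pdegP hff P => /[swap] -> [b [b0 _ sb]] x0.
(* The single basis element may differ from 1; expanding 1 in it as well turns the coefficient of
   [x] into the constant [c / d]. *)
have [c] := sb _ x0; have [d] : exists d, vge P (1 - \sum_i d i *: b i) 1.
  by apply: sb; right; rewrite pval1.
rewrite !big_ord1 => d1 c1.
have d0 : d ord0 != 0.
  apply/eqP => d0; move: d1; rewrite d0 scale0r subr0.
  by move/(vge_neq0 (oner_neq0 _)); rewrite pval1.
exists (c ord0 / d ord0).
have -> : (x - iota (c ord0 / d ord0) : Kmod iota) =
  (x - c ord0 *: b ord0) - (c ord0 / d ord0) *: (1 - d ord0 *: b ord0).
  rewrite scalerBr scalerA divfK // opprB addrA subrK.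
  by rewrite KmodZ [_ * 1]mulr1.
by apply: vgeD => //; exact/vgeN/vgeZ.
Qed.

(** * Divisors and Riemann-Roch spaces *)

Section Divisors.
Variables (F : finFieldType) (K : fieldType) (iota : {rmorphism F -> K}).
Implicit Types (P Q : place iota) (A B : divisor iota) (s : seq (place iota)).

Definition eff s : divisor iota := [seq (Q, 1%Z) | Q <- s].

Definition dscale (m : int) A : divisor iota := [seq (x.1, m * x.2) | x <- A].

Definition deg_eff s : nat := (\sum_(Q <- s) pdeg Q)%N.

Lemma eff_cat s t : eff (s ++ t) = eff s ++ eff t.
Proof. exact: map_cat. Qed.

Lemma divcoef_cat A B P : coef (A ++ B) P = coef A P + coef B P.
Proof. by rewrite /coef big_cat. Qed.

Lemma divcoef_cons x A P : coef (x :: A) P = (if x.1 == P then x.2 else 0) + coef A P.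
Proof. by rewrite /coef big_cons; case: eqP => //; rewrite add0r. Qed.

Lemma ddeg_cat A B : ddeg (A ++ B) = ddeg A + ddeg B.
Proof. by rewrite /ddeg big_cat. Qed.

Lemma divcoef_scale m A P : coef (dscale m A) P = m * coef A P.
Proof. by rewrite /coef /dscale big_map mulr_sumr. Qed.

Lemma ddeg_scale m A : ddeg (dscale m A) = m * ddeg A.
Proof. by rewrite /ddeg /dscale big_map mulr_sumr; apply: eq_bigr => x _; rewrite mulrA. Qed.

Lemma ddeg_eff s : ddeg (eff s) = (deg_eff s)%:Z.
Proof.
rewrite /ddeg /eff /deg_eff big_map (big_morph Posz PoszD (erefl _)).
by apply: eq_bigr => x _; rewrite mul1r.
Qed.

Lemma deg_eff_cat s t : deg_eff (s ++ t) = (deg_eff s + deg_eff t)%N.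
Proof. by rewrite /deg_eff big_cat. Qed.

Lemma deg_eff_nseq n P : pdeg P = 1%N -> deg_eff (nseq n P) = n.
Proof.
by move=> P1; rewrite /deg_eff; elim: n => [|n IH]; rewrite ?big_nil //= big_cons IH P1.
Qed.

Lemma coef_eff_ge0 s P : 0 <= coef (eff s) P.
Proof. by rewrite /coef /eff big_map sumr_ge0. Qed.

Lemma coef_eff s P : coef (eff s) P = (count_mem P s)%:Z.
Proof.
elim: s => [|Q s IH]; first by rewrite /coef big_nil.
by rewrite divcoef_cons IH /=; case: eqP => _; rewrite PoszD.
Qed.

Lemma coef_pos_neg A : exists s t,
  (forall P, coef A P = coef (eff s) P - coef (eff t) P) /\
  ddeg A = (deg_eff s)%:Z - (deg_eff t)%:Z.
Proof.
have nseqE n Q P : coef (eff (nseq n Q)) P = if Q == P then n%:Z else 0.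
  elim: n => [|n IH]; first by rewrite /coef big_nil; case: eqP.
  by rewrite divcoef_cons IH /= -add1n PoszD; case: eqP.
have degE n Q : deg_eff (nseq n Q) = (n * pdeg Q)%N.
  elim: n => [|n IH]; first by rewrite /deg_eff big_nil.
  by rewrite /deg_eff big_cons -/(deg_eff _) IH mulSn.
elim: A => [|[Q m] A [s [t [cA dA]]]].
  exists [::], [::]; split=> [P|]; first by rewrite subrr /coef big_nil.
  by rewrite /ddeg /deg_eff !big_nil subrr.
case: m => n.
  exists (nseq n Q ++ s), t; split=> [P|].
    by rewrite divcoef_cons cA eff_cat divcoef_cat nseqE /= addrA.
  by rewrite /ddeg big_cons -/(ddeg A) dA deg_eff_cat degE /= PoszD PoszM addrA.
exists s, (nseq n.+1 Q ++ t); split=> [P|].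
  rewrite divcoef_cons cA eff_cat divcoef_cat nseqE /=; case: eqP => _; lia.
rewrite /ddeg big_cons -/(ddeg A) dA deg_eff_cat degE /= PoszD PoszM NegzE; lia.
Qed.

(** With A = s - s' and B = t - t' as differences of effective divisors, s + t lies above both.
    Divisors are lists, so agreement is stated on coefficients, and the degrees are compared
    separately. *)
Lemma common_upper_divisor A B : exists s t,
  (forall P, coef (eff s ++ A) P = coef (eff t ++ B) P) /\
  ddeg (eff s ++ A) = ddeg (eff t ++ B).
Proof.
have [s [s' [cA dA]]] := coef_pos_neg A.
have [t [t' [cB dB]]] := coef_pos_neg B.
exists (s' ++ t), (t' ++ s); split=> [P|].
  rewrite !divcoef_cat cA cB !eff_cat !divcoef_cat; lia.
rewrite !ddeg_cat dA dB !ddeg_eff !deg_eff_cat; lia.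
Qed.

(** The list [A] mentions finitely many places, so such a family is automatically integral at all
    the others. *)
Definition adeles_at A (a : place iota -> Kmod iota) :=
  forall P, vge P (a P) (- coef A P).

Definition const_adele (x : Kmod iota) : place iota -> Kmod iota := fun _ => x.

Lemma subsp_adeles_at A : subsp (adeles_at A).
Proof.
split=> [P|a x y xA yA P]; first exact: vge0.
by apply: (subsp_vge P _).2; [exact: xA | exact: yA].
Qed.

Lemma subsp_rr A : subsp (rr_space A).
Proof.
split=> [P|a x y xA yA P]; first exact: vge0.
by apply: (subsp_vge P _).2; [exact: xA | exact: yA].
Qed.

Lemma adeles_at_mono A B a : (forall P, coef A P <= coef B P) ->
  adeles_at A a -> adeles_at B a.
Proof. by move=> AB aA P; apply: vgeW (aA P); rewrite lerN2. Qed.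

Lemma rr_mono A B x : (forall P, coef A P <= coef B P) ->
  rr_space A x -> rr_space B x.
Proof. by move=> AB xA; exact: (adeles_at_mono AB (a := const_adele x)). Qed.

Lemma coef_le_eff s A P : coef A P <= coef (eff s ++ A) P.
Proof. by rewrite divcoef_cat lerDr coef_eff_ge0. Qed.

Lemma rr_mul A B x y : rr_space A x -> rr_space B y -> rr_space (A ++ B) (x * y).
Proof. by move=> xA yB P; rewrite divcoef_cat opprD; apply: vgeM. Qed.

Lemma const_adele_sum (I : finType) (c : I -> F) (u : I -> Kmod iota) :
  \sum_i c i *: const_adele (u i) = const_adele (\sum_i c i *: u i).
Proof. by apply/funext => P; rewrite fct_sumE. Qed.

Hypothesis hff : function_field iota.

(** The two spaces differ only at [Q], where scaling by an element [r] of valuation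
    [- (coef A Q + 1)] identifies the quotient with the residue field. *)
Lemma rdim_adeles_point Q A :
  rdim (adeles_at ((Q, 1%Z) :: A)) (adeles_at A) (pdeg Q).
Proof.
have [b [b0 ib sb]] := pdegP hff Q.
have [r r0 rm] := exists_val Q (- (coef A Q + 1)).
pose e i : place iota -> Kmod iota := fun P => if P == Q then (r : Kmod iota) * b i else 0.
have coefQ : coef ((Q, 1%Z) :: A) Q = coef A Q + 1 by rewrite divcoef_cons eqxx addrC.
have sumQ c : (\sum_i c i *: e i) Q = (r : Kmod iota) * \sum_i c i *: b i.
  by rewrite fct_sumE mulr_sumr; apply: eq_bigr => i _; rewrite /e fctE eqxx Kmod_mulZ.
have sumNQ c P : P != Q -> (\sum_i c i *: e i) P = 0.
  by move=> PQ; rewrite fct_sumE big1 // => i _; rewrite /e fctE (negPf PQ) scaler0.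
have vr : vge Q (r : Kmod iota) (- (coef A Q + 1)) by right; rewrite rm.
exists e; split.
- move=> i P; rewrite /e; case: eqP => [->|_]; last exact: vge0.
  by rewrite coefQ -[X in vge _ _ X]addr0; apply: vgeM.
- move=> c /(_ Q); rewrite sumQ mulrC => /vgeMr/(_ r0 rm) cQ; apply: ib.
  by apply: vgeW cQ; lia.
- move=> a aA; have : vge Q (a Q / r : Kmod iota) 0.
    have rQ : vge Q (a Q / r * r : Kmod iota) (- coef ((Q, 1%Z) :: A) Q).
      by rewrite divfK //; exact: aA.
    apply: vgeW (vgeMr rQ r0 rm).
    rewrite coefQ; lia.
  move=> /sb[c c1]; exists c => P; have [->|PQ] := eqVneq P Q; last first.
    rewrite [X in vge _ X _](_ : _ = a P - (\sum_i c i *: e i) P) // sumNQ // subr0.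
    by have := aA P; rewrite divcoef_cons eq_sym (negPf PQ) add0r.
  rewrite [X in vge _ X _](_ : _ = a Q - (\sum_i c i *: e i) Q) // sumQ.
  have -> : a Q - (r : Kmod iota) * (\sum_i c i *: b i) =
     (r : Kmod iota) * (a Q / r - \sum_i c i *: b i).
    by rewrite mulrBr; congr (_ - _); rewrite [RHS]mulrC divfK.
  by apply: vgeW (vgeM vr c1); lia.
Qed.

Lemma rdim_adeles_eff s A :
  rdim (adeles_at (eff s ++ A)) (adeles_at A) (deg_eff s).
Proof.
elim: s => [|Q s IH].
  rewrite /deg_eff big_nil; exists (fun _ => 0); split=> [[]//|c _ []//|x xA].
  by exists (fun _ => 0); rewrite big_ord0 subr0.
rewrite /deg_eff big_cons -/(deg_eff s).
apply: rdim_trans IH; try exact: subsp_adeles_at.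
- by move=> a; apply: adeles_at_mono => P; exact: coef_le_eff.
- by move=> a; apply: adeles_at_mono => P; exact: (coef_le_eff [:: Q]).
- exact: rdim_adeles_point.
Qed.

(** Constant adeles embed L(A + s)/L(A) in the corresponding quotient of adeles, of dimension deg
    s. *)
Lemma rdim_rr_eff s A : exists2 n, (n <= deg_eff s)%N &
  rdim (rr_space (eff s ++ A)) (rr_space A) n.
Proof.
apply: rdim_exists; try exact: subsp_rr.
move=> n u uA iu; rewrite -[n]card_ord.
apply: (rdim_indep (subsp_adeles_at A) (rdim_adeles_eff s A)
  (u := fun i => const_adele (u i))); first exact: uA.
by move=> c; rewrite const_adele_sum => /iu.
Qed.

End Divisors.

(** * Dimensions of Riemann-Roch spaces from Riemann's inequality *)

Section RiemannRoch.
Variables (F : finFieldType) (K : fieldType) (iota : {rmorphism F -> K}).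
Hypotheses (hff : function_field iota) (hcf : full_constant_field iota).
Variables (g : nat) (hg : is_genus iota g).
Variables (P0 : place iota) (hP0 : pdeg P0 = 1%N).
Implicit Types (P Q : place iota) (A B : divisor iota) (s : seq (place iota)).

Lemma riemann_inequality A : ddeg A + 1 - g%:Z <= (ell A)%:Z.
Proof. by rewrite lerBlDr -lerBlDl addrAC; exact: hg.1. Qed.

(** Adding copies of [P0] reaches a divisor [B] of degree at least [g], where Riemann's inequality
    excludes the default value 0 of [ell]. So L(B) has a finite basis, and L(A) is a subspace of
    it. *)
Lemma rdim_ell A : rdim (rr_space A) (@null F K iota) (ell A).
Proof.
pose B := eff (nseq (`|ddeg A|%N + g) P0) ++ A.
have ellB : rdim (rr_space B) (@null F K iota) (ell B).
  apply/ell_isE; have : ell B != 0%N.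
    have := riemann_inequality B; rewrite /B ddeg_cat ddeg_eff deg_eff_nseq //; lia.
  by rewrite /ell; case: xgetP => // x -> .
have [m _ Am] := rdim_sub (subsp_rr A) (subsp_null iota)
  (fun x => @rr_mono _ _ _ A B x (coef_le_eff _ A)) ellB.
apply/ell_isE; apply: (@xgetI _ 0%N [set m | ell_is A m] m); exact/ell_isE.
Qed.

Lemma ell_ext A B : (forall P, coef A P = coef B P) -> ell A = ell B.
Proof.
move=> AB; rewrite /ell; congr (xget _ _); apply/funext => m; apply/propext.
rewrite /= (propext (ell_isE A m)) (propext (ell_isE B m)); have -> // : rr_space A = rr_space B.
by apply/funext => x; apply/propext; split; apply: rr_mono => P; rewrite AB.
Qed.

Lemma rdim_rr_effE s A : exists n, [/\ (n <= deg_eff s)%N, ell (eff s ++ A) = (n + ell A)%N &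
  rdim (rr_space (eff s ++ A)) (rr_space A) n].
Proof.
have [n ns sA] := rdim_rr_eff hff s A; exists n; split=> //.
apply: (rdim_uniq (subsp_null iota) (rdim_ell _)).
apply: rdim_trans sA (rdim_ell A); try exact: subsp_rr; first exact: subsp_null.
  by move=> x ->; exact: subsp0 (subsp_rr _).
by move=> x; apply: rr_mono => P; exact: coef_le_eff.
Qed.

Lemma ell_eff_le s A : (ell (eff s ++ A) <= deg_eff s + ell A)%N.
Proof. by have [n [ns -> _]] := rdim_rr_effE s A; rewrite leq_add2r. Qed.

Lemma ell_eff_ge s A : (ell A <= ell (eff s ++ A))%N.
Proof. by have [n [ns -> _]] := rdim_rr_effE s A; rewrite leq_addl. Qed.

(** For [y] transcendental, 1, y, ..., y^n with n = l(0) would be n + 1 independent elements of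
    L(0). *)
Lemma rr_nil_const (y : Kmod iota) : rr_space [::] y -> exists c : F, y = iota c.
Proof.
move=> y0; apply: hcf; apply: contrapT => nalg.
pose n := ell ([::] : divisor iota).
suff : (#|'I_n.+1| <= n)%N by rewrite card_ord ltnn.
apply: (rdim_indep (subsp_null iota) (rdim_ell [::]) (u := fun i : 'I_n.+1 => y ^+ i)).
  move=> i; elim: (i : nat) => [|k IH]; last first.
    by rewrite exprS; exact: (rr_mul y0 IH).
  by move=> P; rewrite /coef big_nil oppr0; right; rewrite pval1.
move=> c; rewrite /null => c0.
pose p := \poly_(i < n.+1) (if insub i is Some j then c j else 0).
have pc (i : 'I_n.+1) : p`_i = c i by rewrite coef_poly ltn_ord valK.
move=> i; rewrite -pc; have [->|p0] := eqVneq p 0; first by rewrite coef0.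
case: nalg; exists p => //; rewrite -[RHS]c0 /ev_poly.
rewrite (@horner_coef_wide _ n.+1) ?size_map_poly ?size_poly //.
by apply: eq_bigr => j _; rewrite coef_map pc.
Qed.

Lemma ell_nil : ell ([::] : divisor iota) = 1%N.
Proof.
apply: (rdim_uniq (subsp_null iota) (rdim_ell _)).
exists (fun _ => 1); split.
- by move=> _ P; rewrite /coef big_nil oppr0; right; rewrite pval1.
- move=> c; rewrite /null big_ord1 KmodZ mulr1 => /eqP; rewrite fmorph_eq0 => /eqP c0 i.
  by rewrite ord1.
- move=> y /rr_nil_const[c ->]; exists (fun _ => c); rewrite /null big_ord1 KmodZ.
  by rewrite [iota c * 1]mulr1 subrr.
Qed.

Lemma ell_mul A B (f : Kmod iota) : f != 0 -> rr_space B f -> (ell A <= ell (A ++ B))%N.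
Proof.
move=> f0 fB.
apply: (rdim_rel (R := fun x y : Kmod iota => y = x * f) _ _ _ _ _ (rdim_ell A) (rdim_ell (A ++ B))).
- exact: subsp_null.
- by rewrite mul0r.
- by move=> a x y x' y' -> ->; rewrite mulrDl Kmod_Zmul.
- by move=> x xA; exists (x * f) => //; exact: rr_mul.
- by move=> x y -> /eqP; rewrite mulf_eq0 (negPf f0) orbF => /eqP.
Qed.

Lemma rr_exp A (f : Kmod iota) (n : nat) : rr_space A f -> rr_space (dscale n A) (f ^+ n).
Proof.
move=> fA P; rewrite divcoef_scale; elim: n => [|n IH].
  by rewrite mul0r oppr0; right; rewrite expr0 pval1.
by rewrite exprS; apply: vgeW (vgeM (fA P) IH); lia.
Qed.

(* A nonzero f in L(A) would embed L(-m A) in L(0) by f^m, against Riemann's inequality. *)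
Lemma rr_neg A (f : Kmod iota) : ddeg A < 0 -> rr_space A f -> f = 0.
Proof.
move=> dA fA; apply/eqP; apply: contraT => f0.
(* The exponent gives -(g + 1) A degree at least g + 1, hence dimension at least 2, while l(0) =
   1. *)
have fn0 : f ^+ g.+1 != 0 by rewrite expf_neq0.
have := ell_mul (dscale (- g.+1%:Z) A) fn0 (rr_exp g.+1 fA).
have -> : ell (dscale (- g.+1%:Z) A ++ dscale g.+1%:Z A) = 1%N.
  rewrite -ell_nil; apply: ell_ext => P.
  by rewrite divcoef_cat !divcoef_scale [RHS]big_nil mulNr addNr.
have := riemann_inequality (dscale (- g.+1%:Z) A).
rewrite ddeg_scale; nia.
Qed.

Lemma ell_neg A : ddeg A < 0 -> ell A = 0%N.
Proof.
move=> dA; apply: (rdim_uniq (subsp_null iota) (rdim_ell A)).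
exists (fun _ => 0); split=> [[]//|c _ []//|x /(rr_neg dA) ->].
by exists (fun _ => 0); rewrite big_ord0 /null subrr.
Qed.

(** Removing deg A + 1 copies of [P0] reaches degree -1, where the space is zero; each copy costs at
    most one dimension. *)
Lemma ell_le_deg A : -1 <= ddeg A -> (ell A)%:Z <= ddeg A + 1.
Proof.
move=> dA; pose n := `|(ddeg A + 1)%R|%N.
pose B := dscale (-1) (eff (nseq n P0)) ++ A.
have <- : ell (eff (nseq n P0) ++ B) = ell A.
  by apply: ell_ext => P; rewrite !divcoef_cat divcoef_scale; lia.
have := ell_eff_le (nseq n P0) B; rewrite deg_eff_nseq // (ell_neg (A := B)); first by lia.
by rewrite ddeg_cat ddeg_scale ddeg_eff deg_eff_nseq //; lia.
Qed.

End RiemannRoch.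

(** * Adeles and Weil differentials *)

Section Differentials.
Variables (F : finFieldType) (K : fieldType) (iota : {rmorphism F -> K}).
Hypotheses (hff : function_field iota) (hcf : full_constant_field iota).
Variables (g : nat) (hg : is_genus iota g).
Variables (P0 : place iota) (hP0 : pdeg P0 = 1%N).
Implicit Types (P Q : place iota) (A B W : divisor iota) (s t : seq (place iota)).
Implicit Types (x y z : Kmod iota) (a b : place iota -> Kmod iota).
Implicit Types (l : (place iota -> Kmod iota) -> F^o).

(** The index of speciality; Riemann's inequality makes the integer nonnegative, so the absolute
    value only changes the type. *)
Definition spec A : nat := `|((ell A)%:Z - ddeg A - 1 + g%:Z)%R|%N.

Lemma specE A : (spec A)%:Z = (ell A)%:Z - ddeg A - 1 + g%:Z.
Proof. by move: (riemann_inequality hg A); clear; rewrite /spec; lia. Qed.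

Lemma exists_nonspecial : exists A, spec A = 0%N.
Proof. by case: hg.2 => A hA; exists A; have := specE A; lia. Qed.

Lemma spec_eff_le s A : (spec (eff s ++ A) <= spec A)%N.
Proof.
have := specE (eff s ++ A); have := specE A; rewrite ddeg_cat ddeg_eff.
by have := ell_eff_le hff hg hP0 s A; lia.
Qed.

(* Every element of K has finitely many poles, but this need not be proved: the subring of
   those that do is closed under inverses, which is enough for the adelic argument. *)
Definition finite_poles x := exists A, rr_space A x.

Definition is_adele a := exists A, adeles_at A a.

Lemma finite_polesM x y : finite_poles x -> finite_poles y -> finite_poles (x * y).
Proof. by move=> [A xA] [B yB]; exists (A ++ B); exact: rr_mul. Qed.

(** Take [s] of largest degree with x in L(A - s); this exists because L vanishes in negative
    degree. Maximality leaves no slack at any place, so the divisor of [x] is s - A. *)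
Lemma exact_divisor x : x != 0 -> finite_poles x ->
  exists D, forall P, P x = coef D P.
Proof.
move=> x0 [A xA].
pose R n := `[< exists s, deg_eff s = n /\ rr_space (dscale (-1) (eff s) ++ A) x >].
have R0 : exists n, R n.
  by exists 0%N; apply/asboolP; exists [::]; split; rewrite // /deg_eff big_nil.
have Rb n : R n -> (n <= `|ddeg A|)%N.
  move=> /asboolP[s [<- sA]]; rewrite leqNgt; apply/negP => ltA.
  move: x0; rewrite (rr_neg hcf hg hP0 _ sA) ?eqxx //.
  by rewrite ddeg_cat ddeg_scale ddeg_eff; lia.
case: (ex_maxnP R0 Rb) => n /asboolP[s [sn sA]] nmax.
exists (eff s ++ dscale (-1) A) => P; rewrite divcoef_cat divcoef_scale.
have := vge_neq0 x0 (sA P); rewrite divcoef_cat divcoef_scale => lexP.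
apply/eqP; rewrite eq_le; apply/andP; split; last by lia.
rewrite leNgt; apply/negP => ltP.
suff /nmax : R (deg_eff (P :: s)).
  by rewrite /deg_eff big_cons -/(deg_eff s) sn; have := pdeg_gt0 hff P; lia.
apply/asboolP; exists (P :: s); split=> // Q; right.
have := vge_neq0 x0 (sA Q); rewrite !divcoef_cat !divcoef_scale /= divcoef_cons /=.
by case: eqP => [<-|_]; lia.
Qed.

Lemma finite_polesV x : finite_poles x -> finite_poles x^-1.
Proof.
have [->|x0] := eqVneq x 0; first by rewrite invr0.
move=> /(exact_divisor x0)[D xD]; exists D => P; right.
by rewrite pvalV // xD.
Qed.

Lemma subsp_finite_poles : subsp finite_poles.
Proof.
split; first by exists [::] => P; exact: vge0.
move=> c x y [A xA] [B yB]; have [s [t [AB _]]] := common_upper_divisor A B.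
exists (eff s ++ A); apply: (subsp_rr _).2.
  by apply: rr_mono xA => P; exact: coef_le_eff.
by apply: rr_mono yB => P; rewrite AB; exact: coef_le_eff.
Qed.

Lemma subsp_adele : subsp is_adele.
Proof.
split; first by exists [::] => P; exact: vge0.
move=> c x y [A xA] [B yB]; have [s [t [AB _]]] := common_upper_divisor A B.
exists (eff s ++ A); apply: (subsp_adeles_at _).2.
  by apply: adeles_at_mono xA => P; exact: coef_le_eff.
by apply: adeles_at_mono yB => P; rewrite AB; exact: coef_le_eff.
Qed.

Lemma adele_const x : finite_poles x -> is_adele (const_adele x).
Proof. by case=> A xA; exists A. Qed.

Lemma const_adeleB x y : const_adele (x - y) = const_adele x - const_adele y.
Proof. by []. Qed.

Definition adele_mul x a : place iota -> Kmod iota := fun P => x * a P.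

Lemma adele_mulA x y a : adele_mul x (adele_mul y a) = adele_mul (x * y) a.
Proof. by apply/funext => P; rewrite /adele_mul mulrA. Qed.

Lemma adele_mul1 a : adele_mul 1 a = a.
Proof. by apply/funext => P; rewrite /adele_mul mul1r. Qed.

Lemma adele_mul_at A B x a : rr_space A x -> adeles_at B a ->
  adeles_at (A ++ B) (adele_mul x a).
Proof. by move=> xA aB P; rewrite divcoef_cat opprD; apply: vgeM. Qed.

Lemma is_adele_mul x a : finite_poles x -> is_adele a -> is_adele (adele_mul x a).
Proof. by move=> [A xA] [B aB]; exists (A ++ B); exact: adele_mul_at. Qed.

Lemma adele_mulLr x c a b : adele_mul x (c *: a + b) = c *: adele_mul x a + adele_mul x b.
Proof. by apply/funext => P; rewrite /adele_mul mulrDr Kmod_mulZ. Qed.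

Lemma adele_mulLl c x y a : adele_mul (c *: x + y) a = c *: adele_mul x a + adele_mul y a.
Proof. by apply/funext => P; rewrite /adele_mul mulrDl Kmod_Zmul. Qed.

Lemma adele_mul_sum (I : finType) (c : I -> F) (u : I -> Kmod iota) a :
  adele_mul (\sum_i c i *: u i) a = \sum_i c i *: adele_mul (u i) a.
Proof.
apply/funext => P; rewrite fct_sumE /adele_mul mulr_suml.
by apply: eq_bigr => i _; rewrite Kmod_Zmul.
Qed.

(** For [B] nonspecial, L(B + s)/L(B) has the full dimension deg s, so the constants already fill
    the quotient of the adeles for B + s by those for B. *)
Lemma adele_approx B a : spec B = 0%N -> is_adele a ->
  exists2 x, finite_poles x & adeles_at B (a - const_adele x).
Proof.
move=> sB [A aA]; have [s [t [BA _]]] := common_upper_divisor B A.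
have aB : adeles_at (eff s ++ B) a.
  by apply: adeles_at_mono aA => P; rewrite BA; exact: coef_le_eff.
have [n [ns En sn]] := rdim_rr_effE hff hg hP0 s B.
have {}ns : n = deg_eff s.
  have := spec_eff_le s B; have := specE (eff s ++ B); have := specE B.
  by rewrite ddeg_cat ddeg_eff; lia.
move: sn; rewrite ns => -[u [uB iu su]].
have [c cB] := rdim_full (subsp_adeles_at _) (subsp_adeles_at _)
  (rdim_adeles_eff hff s B) (b := fun i => const_adele (u i)) uB
  (fun c => eq_ind_r (fun v => adeles_at B v -> _) (iu c) (const_adele_sum c u)) aB.
exists (\sum_i c i *: u i); last by rewrite -const_adele_sum.
apply: (subsp_lin c subsp_finite_poles) => i; exists (eff s ++ B); exact: uB.
Qed.

Definition principal a := exists2 x, finite_poles x & a = const_adele x.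

Lemma subsp_principal : subsp principal.
Proof.
split; first by exists 0; [exact: subsp0 subsp_finite_poles | ].
move=> c a b [x xp ->] [y yp ->]; exists (c *: x + y) => //.
exact: subsp_finite_poles.2.
Qed.

Definition at_plus_principal A a := exists2 b, adeles_at A b & principal (a - b).

Lemma subsp_at_plus_principal A : subsp (at_plus_principal A).
Proof. exact: subsp_add (subsp_adeles_at A) subsp_principal. Qed.

Lemma at_plus_principal_adele A a : at_plus_principal A a -> is_adele a.
Proof.
move=> [b bA [x xp abx]]; rewrite -(subrK b a) abx.
by apply: (subspD subsp_adele); [exact: adele_const | exists A].
Qed.

(* This quotient is H^1(A). *)
Lemma rdim_cokernel A : rdim is_adele (at_plus_principal A) (spec A).
Proof.
have [A0 sA0] := exists_nonspecial.
have [s [t [AB dAB]]] := common_upper_divisor A A0.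
(* [B] lies above a nonspecial divisor, hence is nonspecial itself. *)
pose B := eff s ++ A.
have sB : spec B = 0%N.
  have := spec_eff_le t A0; have := specE (eff t ++ A0); have := specE B.
  by rewrite /B (ell_ext AB) dAB; lia.
(* [M] is the sum of L(B) and the adeles for [A]. Of the dimension deg s between [A] and [B], the
   part below [M] is l(B) - l(A); what remains above is [spec A]. *)
pose M a := exists2 b, adeles_at A b & exists2 x, rr_space B x & a - b = const_adele x.
have sM : subsp M.
  apply: (subsp_add (subsp_adeles_at A)
    (T := fun a => exists2 x, rr_space B x & a = const_adele x)).
  split; first by exists 0; [exact: subsp0 (subsp_rr B) | ].
  by move=> c a b [x xp ->] [y yp ->]; exists (c *: x + y) => //; exact: (subsp_rr B).2.
have AM a : adeles_at A a -> M a.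
  by move=> aA; exists a => //; exists 0; [exact: subsp0 (subsp_rr B) | rewrite subrr].
have MB a : M a -> adeles_at B a.
  move=> [b bA [x xB abx]]; rewrite -(subrK b a) abx.
  apply: (subspD (subsp_adeles_at B)) => //.
  by apply: adeles_at_mono bA => P; exact: coef_le_eff.
have [m [p [Bm Mp mp]]] := rdim_split (subsp_adeles_at B) sM (subsp_adeles_at A)
  AM MB (rdim_adeles_eff hff s A).
have [n [ns En [u [uB iu su]]]] := rdim_rr_effE hff hg hP0 s A.
have Mn : rdim M (adeles_at A) n.
  exists (fun i => const_adele (u i)); split.
  - by move=> i; exists 0; [exact: subsp0 (subsp_adeles_at A) |
      exists (u i); [exact: uB | rewrite subr0]].
  - by move=> c; rewrite const_adele_sum => /iu.
  - move=> a [b bA [x /su[c cA] abx]]; exists c.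
    rewrite const_adele_sum -(subrK b a) abx addrAC -const_adeleB.
    exact: (subspD (subsp_adeles_at A)).
have pn := rdim_uniq (subsp_adeles_at A) Mp Mn.
have <- : m = spec A.
  by have := specE A; have := specE B; rewrite sB /B ddeg_cat ddeg_eff En; lia.
have [e [eB ie se]] := Bm; exists e; split.
- by move=> i; exists B; exact: eB.
(* A constant that is a difference of adeles for [B] lies in L(B), so independence modulo [M]
   persists when all principal adeles are allowed. *)
- move=> c [b bA [x _ cbx]]; apply: ie; exists b => //; exists x => //.
  have : adeles_at B (const_adele x).
    rewrite -cbx; apply: (subspB (subsp_adeles_at B)).
      exact: (subsp_lin c (subsp_adeles_at B)).
    by apply: adeles_at_mono bA => P; exact: coef_le_eff.
  by [].
- move=> a /(adele_approx sB)[x xp /se[c [b bA [y yB cby]]]].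
  exists c, b => //; exists (x + y).
    by apply: (subspD subsp_finite_poles) => //; exists B.
  have -> : const_adele (x + y) = const_adele x + const_adele y by [].
  by rewrite -cby [RHS]addrA [const_adele x + _]addrA [const_adele x + _]addrC subrK.
Qed.

(** The Weil differentials with divisor at least [A], up to their values off the adeles;
    [null_differential] is the zero class. *)
Definition differential A l := annihilator is_adele (at_plus_principal A) l.

Definition null_differential l := annihilator is_adele is_adele l.

Lemma rdim_differential A : rdim (differential A) null_differential (spec A).
Proof.
apply: rdim_dual (rdim_cokernel A); first exact: subsp_adele.
  exact: subsp_at_plus_principal.
exact: at_plus_principal_adele.
Qed.

Lemma differentialP A l : differential A l <->
  [/\ functional_on is_adele l, forall a, adeles_at A a -> l a = 0
    & forall x, finite_poles x -> l (const_adele x) = 0].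
Proof.
split=> [[lS lT]|[lS lA lx]].
  split=> // [a aA|x xp]; apply: lT.
    by exists a => //; exists 0; [exact: subsp0 subsp_finite_poles | rewrite subrr].
  exists 0; first exact: subsp0 (subsp_adeles_at A).
  by exists x => //; rewrite subr0.
split=> // a [b bA [x xp abx]]; rewrite -(subrK b a) abx -[const_adele x]scale1r.
rewrite (lS 1 _ _ (adele_const xp)); last by exists A.
by rewrite (lA b bA) (lx x xp) mulr0 addr0.
Qed.

Lemma differential_mul A B W x l : rr_space B x -> (forall P, coef B P + coef A P <= coef W P) ->
  differential W l -> differential A (fun a => l (adele_mul x a)).
Proof.
move=> xB BAW /differentialP[lS lA lx]; have xp : finite_poles x by exists B.
apply/differentialP; split.
- by move=> c a b aa ba; rewrite adele_mulLr lS //; exact: is_adele_mul.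
- move=> a aA; apply: lA; apply: adeles_at_mono (adele_mul_at xB aA) => P.
  by rewrite divcoef_cat.
- by move=> y yp; apply: (lx (x * y)); exact: finite_polesM.
Qed.

Lemma null_differential_mul x l : x != 0 -> finite_poles x ->
  functional_on is_adele l -> (forall a, is_adele a -> l (adele_mul x a) = 0) ->
  null_differential l.
Proof.
move=> x0 xp lS lx; split=> // a aa; rewrite -(adele_mul1 a) -(mulfV x0) -adele_mulA.
by apply: lx; apply: is_adele_mul => //; exact: finite_polesV.
Qed.

(** Sending x to x l embeds L(W) in the differentials for the zero divisor, of dimension g; combine
    l(W) <= g with [spec W] >= 1. *)
Lemma differential_deg W l : differential W l -> ~ null_differential l ->
  ddeg W <= 2 * g%:Z - 2.
Proof.
move=> lW nl; have lS := lW.1.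
have sW : spec W != 0%N.
  apply/eqP => sW; have := rdim_differential W; rewrite sW => -[b [_ _ sb]].
  by apply: nl; have [c] := sb _ lW; rewrite big_ord0 subr0.
suff : (ell W <= spec [::])%N.
  have := specE W; have := specE [::].
  by rewrite (ell_nil hcf hg hP0) [ddeg [::]]big_nil; lia.
apply: (rdim_rel (R := fun x l' => finite_poles x /\
    forall a, is_adele a -> l' a = l (adele_mul x a)) _ _ _ _ _
  (rdim_ell hg hP0 W) (rdim_differential [::])).
- exact: subsp_annihilator.
- split; first exact: subsp0 subsp_finite_poles.
  move=> a aa; have -> : adele_mul 0 a = 0 by apply/funext => P; exact: mul0r.
  by rewrite (functional_on0 subsp_adele lS).
- move=> c x y l1 l2 [xp xl] [yp yl]; split; first exact: subsp_finite_poles.2.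
  move=> a aa; rewrite adele_mulLl (lS _ _ _ (is_adele_mul xp aa) (is_adele_mul yp aa)).
  by rewrite -(xl a aa) -(yl a aa).
- move=> x xW; exists (fun a => l (adele_mul x a)); last by split=> //; exists W.
  by apply: differential_mul xW _ lW => P; rewrite [coef [::] P]big_nil addr0.
- move=> x l' [xp xl] [_ l'0]; apply/eqP; apply: contra_notT nl => x0.
  by apply: (null_differential_mul x0 xp lS) => a aa; rewrite -xl // l'0.
Qed.

(* For n large, the elements x l1 + y l2 with x, y in L(A + n P0) all lie in the space of
   differentials for - n P0, whose dimension n + g - 1 is less than 2 l(A + n P0). *)
Lemma differential_proportional A l1 l2 :
  differential A l1 -> differential A l2 ->
  ~ null_differential l1 -> ~ null_differential l2 ->
  exists z, [/\ z != 0, finite_poles z &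
    forall a, is_adele a -> l2 a = l1 (adele_mul z a)].
Proof.
move=> l1A l2A nl1 nl2; have [l1S l2S] := (l1A.1, l2A.1).
(* This size makes 2 (n + deg A + 1 - g) exceed n + g - 1, and n > 0 makes L(-n P0) zero. *)
pose n := (3 * g + 2 * `|ddeg A| + 1)%N.
pose D := eff (nseq n P0).
pose B := D ++ A.
have [u [uB iu _]] := rdim_ell hg hP0 B.
have up i : finite_poles (u i) by exists B; exact: uB.
pose w (k : 'I_(ell B) + 'I_(ell B)) : (place iota -> Kmod iota) -> F^o :=
  match k with inl i => fun a => l1 (adele_mul (u i) a)
             | inr i => fun a => l2 (adele_mul (u i) a) end.
have BDA P : coef B P + coef (dscale (-1) D) P <= coef A P.
  by rewrite divcoef_cat divcoef_scale; lia.
have wD k : differential (dscale (-1) D) (w k).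
  by case: k => i; apply: differential_mul (uB i) BDA _.
have : ~ indep null_differential w.
  move=> iw; have := rdim_indep (subsp_annihilator _ _)
    (rdim_differential (dscale (-1) D)) wD iw.
  rewrite card_sum !card_ord; have := specE (dscale (-1) D).
  have := riemann_inequality hg B.
  have dD : ddeg D = n%:Z by rewrite ddeg_eff deg_eff_nseq.
  have -> : ell (dscale (-1) D) = 0%N.
    by apply: (ell_neg hcf hg hP0); rewrite ddeg_scale dD /n; lia.
  by rewrite ddeg_cat ddeg_scale dD /n; lia.
move=> /existsNP[c /not_implyP[cw /existsNP c0]].
pose x := \sum_i c (inl i) *: u i; pose y := \sum_i c (inr i) *: u i.
have xp : finite_poles x by exact: (subsp_lin _ subsp_finite_poles).
have yp : finite_poles y by exact: (subsp_lin _ subsp_finite_poles).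
have xy a : is_adele a -> l1 (adele_mul x a) + l2 (adele_mul y a) = 0.
  move=> aa; rewrite !adele_mul_sum.
  rewrite !(functional_on_sum _ subsp_adele) //; try by move=> i; exact: is_adele_mul.
  rewrite -[RHS](cw.2 a aa) fct_sumE big_sumType /=; congr (_ + _).
(* If y = 0, all its coefficients vanish, so x is nonzero and x l1 = 0, which forces l1 to be
   null. *)
have y0 : y != 0.
  apply/eqP => y0; have cr := iu _ y0; apply: nl1.
  have x0 : x != 0.
    apply/eqP => /iu cl; by case: c0 => -[i|i]; apply; [exact: cl | exact: cr].
  apply: (null_differential_mul x0 xp l1S) => a aa.
  rewrite -[LHS]addr0 -[RHS](xy a aa); congr (_ + _).
  rewrite y0; have -> : adele_mul 0 a = 0 by apply/funext => P; exact: mul0r.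
  by rewrite (functional_on0 subsp_adele l2S).
have x0 : x != 0.
  apply/eqP => x0; apply: nl2; apply: (null_differential_mul y0 yp l2S) => a aa.
  rewrite -[LHS]add0r -[RHS](xy a aa); congr (_ + _).
  rewrite x0; have -> : adele_mul 0 a = 0 by apply/funext => P; exact: mul0r.
  by rewrite (functional_on0 subsp_adele l1S).
(* The relation x l1 + y l2 = 0, evaluated at a / y, gives l2 = -(x / y) l1. *)
exists (- (x / y)); split.
- by rewrite oppr_eq0 mulf_neq0 // invr_eq0.
- by apply: (subspN subsp_finite_poles); apply: finite_polesM => //; exact: finite_polesV.
move=> a aa; have ya : is_adele (adele_mul y^-1 a).
  by apply: is_adele_mul => //; exact: finite_polesV.
have := xy _ ya; rewrite !adele_mulA mulfV // adele_mul1 => /eqP.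
rewrite addr_eq0 => /eqP E.
have -> : adele_mul (- (x / y)) a = (-1) *: adele_mul (x / y) a + 0.
  by apply/funext => P; rewrite scaleN1r addr0 /adele_mul mulNr.
rewrite (l1S _ _ _ _ (subsp0 subsp_adele)).
  by rewrite (functional_on0 subsp_adele l1S) addr0 E mulrN mulN1r opprK.
by apply: is_adele_mul => //; apply: finite_polesM => //; exact: finite_polesV.
Qed.

(** The degree bound 2g - 2 permits a choice of [W] of maximal degree, and places have positive
    degree. This [W] serves as the divisor of [l]. *)
Lemma maximal_divisor A l : differential A l -> ~ null_differential l ->
  exists2 W, differential W l & forall P, ~ differential ((P, 1%Z) :: W) l.
Proof.
move=> lA nl.
pose R n := `[< exists W, differential W l /\ n%:Z = 2 * g%:Z - 2 - ddeg W >].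
have R0 : exists n, R n.
  exists `|(2 * g%:Z - 2 - ddeg A)%R|%N; apply/asboolP; exists A; split=> //.
  by have := differential_deg lA nl; lia.
case: (ex_minnP R0) => n /asboolP[W [lW nW]] nmin; exists W => // P lPW.
have := differential_deg lPW nl; rewrite -[(P, _) :: W]/(eff [:: P] ++ W).
rewrite ddeg_cat ddeg_eff /deg_eff big_seq1 => dW.
have : R `|(2 * g%:Z - 2 - ddeg (eff [:: P] ++ W))%R|%N.
  apply/asboolP; exists ((P, 1%Z) :: W); split=> //.
  by rewrite -[(P, _) :: W]/(eff [:: P] ++ W) ddeg_cat ddeg_eff /deg_eff big_seq1; lia.
move/nmin; rewrite ddeg_cat ddeg_eff /deg_eff big_seq1.
by have := pdeg_gt0 hff P; lia.
Qed.

(** If z had too small a valuation at [P], every adele for W + P would split as [b + z d], with [b]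
    an adele for [W] that is zero at [P] and [d] an adele for [A] supported at [P]. Then [l] would
    vanish on it, against maximality. *)
Lemma maximal_divisor_rr A W l z : differential W l ->
  (forall P, ~ differential ((P, 1%Z) :: W) l) -> z != 0 ->
  differential A (fun a => l (adele_mul z a)) ->
  rr_space (dscale (-1) A ++ W) z.
Proof.
move=> /differentialP[lS lW lx] Wmax z0 /differentialP[_ zA _] P; right.
rewrite divcoef_cat divcoef_scale leNgt; apply/negP => ltP.
apply: (Wmax P); apply/differentialP; split=> // a aW.
pose b Q := if Q == P then 0 else a Q.
pose d Q := if Q == P then z^-1 * a Q else 0.
have -> : a = 1 *: b + adele_mul z d.
  apply/funext => Q; rewrite scale1r /b /d [RHS](_ : _ =
    (if Q == P then 0 else a Q) + z * (if Q == P then z^-1 * a Q else 0)) //.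
  by case: eqP => _; rewrite ?add0r ?mulr0 ?addr0 // mulVKf.
have bW : adeles_at W b.
  move=> Q; rewrite /b; case: eqVneq => [_|QP]; first exact: vge0.
  by have := aW Q; rewrite divcoef_cons eq_sym (negPf QP) add0r.
have dA : adeles_at A d.
  move=> Q; rewrite /d; case: eqVneq => [->|_]; last exact: vge0.
  have zV : vge P (z^-1 : Kmod iota) (- P z) by right; rewrite pvalV.
  apply: vgeW (vgeM zV (aW P)); rewrite divcoef_cons eqxx /=; lia.
rewrite (lS 1 b); first by rewrite (lW b bW) (zA d dA) mulr0 addr0.
  by exists W.
exists ((P, 1%Z) :: W) => Q; rewrite /adele_mul /d; case: eqVneq => [->|_].
  by rewrite mulVKf //; exact: aW.
by rewrite mulr0; exact: vge0.
Qed.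

(** The divisor is W - A, with [W] maximal for the first of two independent differentials; 1 and
    their quotient [z] lie in its space. *)
Lemma special_pair A : (2 <= spec A)%N ->
  exists2 B : divisor iota, (2 <= ell B)%N & ddeg B <= 2 * g%:Z - 2 - ddeg A.
Proof.
move=> sA; have [l [lA il _]] := rdim_differential A.
pose i1 : 'I_(spec A) := Ordinal (ltnW sA); pose i2 : 'I_(spec A) := Ordinal sA.
(* At c = 0 this says that the second differential is not null; general [c] will show that [z] is
   not a constant. *)
have ncomb c : ~ null_differential (c *: l i1 + l i2).
  move=> H; have /il/(_ i2) : null_differential
      (\sum_i (if i == i1 then c else if i == i2 then 1 else 0) *: l i).
    rewrite (bigD1 i1) //= (bigD1 i2) //= big1 => [|i /andP[/negPf -> /negPf ->]]; last first.
      by rewrite scale0r.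
    by rewrite ?eqxx addr0 scale1r.
  by move=> /= /eqP; rewrite ?eqxx oner_eq0.
have nl2 : ~ null_differential (l i2).
  by move: (ncomb 0); rewrite scale0r add0r.
have nl1 : ~ null_differential (l i1).
  move=> H; have /il/(_ i1) : null_differential (\sum_i (i == i1)%:R *: l i).
    rewrite (bigD1 i1) //= big1 => [|i /negPf ->]; last by rewrite scale0r.
    by rewrite ?eqxx addr0 scale1r.
  by move=> /= /eqP; rewrite ?eqxx oner_eq0.
have [z [z0 zp zl]] := differential_proportional (lA i1) (lA i2) nl1 nl2.
have [W lW Wmax] := maximal_divisor (lA i1) nl1.
have z1 : rr_space (dscale (-1) A ++ W) 1.
  apply: (maximal_divisor_rr lW Wmax) (oner_neq0 _) _.
  by under eq_fun do rewrite adele_mul1; exact: lA.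
have zW : rr_space (dscale (-1) A ++ W) z.
  apply: (maximal_divisor_rr lW Wmax) z0 _; have [l1S l1A l1x] := (differentialP A (l i1)).1 (lA i1).
  have [l2S l2A l2x] := (differentialP A (l i2)).1 (lA i2).
  apply/differentialP; split.
  - move=> c a b aa ba; rewrite -(zl a aa) -(zl b ba) -(l2S c a b aa ba).
    by rewrite -zl //; exact: subsp_adele.2.
  - by move=> a aA; rewrite -(zl a); [exact: l2A | exists A].
  - by move=> x xp; rewrite -zl; [exact: l2x | exact: adele_const].
exists (dscale (-1) A ++ W); last first.
  by rewrite ddeg_cat ddeg_scale; have := differential_deg lW nl1; lia.
rewrite -[2%N](card_ord 2).
apply: (rdim_indep (subsp_null iota) (rdim_ell hg hP0 _)
  (u := fun i : 'I_2 => if i == ord0 then 1 else z)).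
  by move=> i; case: ifP.
move=> c; rewrite /null big_ord_recr big_ord1 /= => cz.
set c0 := c _ in cz; have c1 : c ord_max = 0.
  apply/eqP; apply: contra_notT (ncomb (c0 / c ord_max)) => c1.
  have zE : z = - (c0 / c ord_max) *: (1 : Kmod iota).
    apply/eqP; rewrite scaleNr -addr_eq0 addrC; apply/eqP.
    apply: (scalerI c1); rewrite scaler0 -[RHS]cz scalerDr scalerA.
    by rewrite [c ord_max * _]mulrC divfK.
  have lS k : functional_on is_adele (l k) := (lA k).1.
  have val0 a : is_adele a -> ((c0 / c ord_max) *: l i1 + l i2) a = 0.
    move=> aa; rewrite [LHS](_ : _ = c0 / c ord_max * l i1 a + l i2 a) // zl // zE.
    have -> : adele_mul (- (c0 / c ord_max) *: (1 : Kmod iota)) a =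
        - (c0 / c ord_max) *: a + 0.
      by apply/funext => P; rewrite addr0 /adele_mul Kmod_Zmul mul1r.
    rewrite (lS i1 _ _ _ aa (subsp0 subsp_adele)).
    by rewrite (functional_on0 subsp_adele (lS i1)) addr0 mulNr subrr.
  split=> // u v w uu ww; rewrite !val0 ?mulr0 ?addr0 //.
  exact: subsp_adele.2.
move: cz; rewrite c1 scale0r addr0 => /eqP; rewrite KmodZ mulr1 fmorph_eq0 => /eqP cz.
by case=> -[|[|//]] i; [rewrite -[RHS]cz | rewrite -[RHS]c1]; congr c; exact: val_inj.
Qed.

End Differentials.

(** * Trellis state complexity *)

Section Codes.
Variables (F : fieldType) (n : nat).
Implicit Types (C U : {vspace 'rV[F]_n}) (S : pred 'I_n).

Lemma coordsub_out S (c : 'rV[F]_n) j : c \in coordsub F S -> ~~ S j -> c 0 j = 0.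
Proof.
move=> /(@coord_span _ _ _ (in_tuple [seq delta_mx (ord0 : 'I_1) j | j <- enum S])) -> nSj.
rewrite summxE big1 // => i _; rewrite mxE /=.
have : [seq delta_mx (ord0 : 'I_1) j | j <- enum S]`_i \in
  [seq (delta_mx (ord0 : 'I_1) j : 'rV[F]_n) | j <- enum S] by exact: mem_nth.
case/mapP => k; rewrite mem_enum => Sk ->.
rewrite mxE [j == k](_ : _ = false) ?andbF ?mulr0 //.
by apply: contraNF nSj => /eqP ->.
Qed.

Lemma rdim_vspace U : rdim (fun c => c \in U) (fun c => c = 0) (\dim U).
Proof.
exists (fun i => (vbasis U)`_i); split.
- by move=> i; apply: vbasis_mem; apply: mem_nth; rewrite size_tuple.
- by move=> c; apply/freeP; exact: basis_free (vbasisP U).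
- by move=> x /coord_vbasis xE; exists (fun i => coord (vbasis U) i x); rewrite -xE subrr.
Qed.

Lemma bigminn_le (I : eqType) (r : seq I) (f : I -> nat) x i :
  i \in r -> (\big[minn/x]_(j <- r) f j <= f i)%N.
Proof.
elim: r => // j r IH; rewrite inE big_cons => /orP[/eqP ->|/IH]; first exact: geq_minl.
by apply: leq_trans; exact: geq_minr.
Qed.

Lemma state_cx_ge C i : (i <= n)%N -> (\dim C - Delta C i <= state_cx C)%N.
Proof.
move=> lin; apply: leq_sub2l.
exact: (bigminn_le (fun j : 'I_n.+1 => Delta C j) _ (mem_index_enum (Ordinal (lin : i < n.+1)%N))).
Qed.

Lemma dim_permcode (s : 'S_n) C : \dim (permcode s C) = \dim C.
Proof.
apply: limg_dim_eq; apply/eqP; rewrite -subv0; apply/subvP => c.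
rewrite memv_cap => /andP[_]; rewrite memv_ker lfunE /= => /eqP c0.
by rewrite memv0 -(mulmxK (unitmx_perm _ s) c) c0 mul0mx.
Qed.

Lemma mem_permcode (s : 'S_n) C (c : 'rV[F]_n) :
  c \in permcode s C <-> col_perm s c \in C.
Proof.
have E (d : 'rV[F]_n) : linfun (mulmxr (perm_mx s)) d = col_perm s^-1 d.
  by rewrite lfunE /= col_permE invgK.
split=> [/memv_imgP[d dC ->]|cC].
  by rewrite E -col_permM mulgV col_perm1.
by apply/memv_imgP; exists (col_perm s c) => //; rewrite E -col_permM mulVg col_perm1.
Qed.

End Codes.

(** * Codes from curves: subcodes bounded by Riemann-Roch spaces *)

Section GoppaCodes.
Variables (F : finFieldType) (K : fieldType) (iota : {rmorphism F -> K}).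
Hypotheses (hff : function_field iota) (hcf : full_constant_field iota).
Variables (g : nat) (hg : is_genus iota g).
Variables (gam : int) (hgam : is_gonality iota gam).
Variables (n : nat) (P : 'I_n -> place iota).
Hypotheses (hPinj : injective P) (hPrat : forall i, pdeg (P i) = 1%N).
Variables (G : divisor iota).
Hypothesis hG : forall i, coef G (P i) = 0.
Variable (C : {vspace 'rV[F]_n}).
Hypothesis hC : forall c : 'rV[F]_n, c \in C <->
  exists f : K, inL G f /\ forall i : 'I_n, vge (P i) (f - iota (c 0 i)) 1.
Hypotheses (hkn : (2 * \dim C <= n)%N) (hng : (2 * g < n)%N).
Implicit Types (S : pred 'I_n) (c : 'rV[F]_n) (f : Kmod iota).

(** As n > 2g forces n > 0, a point of the code serves as the [P0] of the preceding results. *)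
Lemma exists_rational_place : exists Q : place iota, pdeg Q = 1%N.
Proof. by case: (n) hng P hPrat => // m _ P' r; exists (P' ord0). Qed.

Definition points S : seq (place iota) := [seq P j | j <- enum S].

Definition minus_points S : divisor iota := dscale (-1) (eff (points S)) ++ G.

Lemma deg_points S : deg_eff (points S) = #|S|.
Proof.
by rewrite /deg_eff big_map big_enum (eq_bigr (fun => 1%N)) ?sum1_card // => i _.
Qed.

Lemma ddeg_minus_points S : ddeg (minus_points S) = ddeg G - #|S|%:Z.
Proof. by rewrite ddeg_cat ddeg_scale ddeg_eff deg_points; lia. Qed.

Lemma coef_points S j : coef (eff (points S)) (P j) = (S j)%:Z.
Proof.
rewrite coef_eff count_uniq_mem; last by rewrite map_inj_uniq // enum_uniq.
by rewrite mem_map // mem_enum.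
Qed.

(** The points are distinct and [G] has coefficient 0 at them, so subtracting those in [S] asks
    exactly for a zero at each. *)
Lemma minus_points_mem S f : rr_space G f -> (forall j, S j -> vge (P j) f 1) ->
  rr_space (minus_points S) f.
Proof.
move=> fG fS Q; rewrite divcoef_cat divcoef_scale.
have [/mapP[j]|nQ] := boolP (Q \in points S); last first.
  by rewrite coef_eff (count_memPn nQ) mulr0 add0r; exact: fG.
rewrite mem_enum => Sj ->; rewrite coef_points hG [S j]Sj.
exact: fS.
Qed.

Definition reduces_to c f := forall j, vge (P j) (f - iota (c 0 j) : Kmod iota) 1.

Lemma reduces_to0 : reduces_to 0 0.
Proof. by move=> j; rewrite mxE rmorph0 subr0; exact: vge0. Qed.

Lemma reduces_toL a c d f h : reduces_to c f -> reduces_to d h ->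
  reduces_to (a *: c + d) (a *: f + h).
Proof.
move=> cf dh j; rewrite !mxE rmorphD rmorphM.
have -> : (a *: f + h - (iota a * iota (c 0 j) + iota (d 0 j)) : Kmod iota) =
  a *: (f - iota (c 0 j) : Kmod iota) + (h - iota (d 0 j)).
  by rewrite scalerBr opprD addrACA.
by apply: vgeD => //; exact: vgeZ.
Qed.

Lemma const_vge1 (Q : place iota) (a : F) : vge Q (iota a : Kmod iota) 1 -> a = 0.
Proof.
move=> a1; apply/eqP; apply: contraT => a0.
have : (iota a : Kmod iota) != 0 by rewrite fmorph_eq0.
by move/vge_neq0/(_ a1); rewrite val_const.
Qed.

(** A codeword supported on [S] lifts to a function in L(G) vanishing at the other points, and the
    zero function reduces only to the zero word. *)
Lemma dim_subcode_le S :
  (\dim (C :&: coordsub F S) <= ell (minus_points (predC S)))%N.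
Proof.
have [Q Q1] := exists_rational_place.
apply: (rdim_rel (R := reduces_to) _ _ _ _ _ (rdim_vspace _) (rdim_ell hg Q1 _)).
- exact: subsp_null.
- exact: reduces_to0.
- by move=> a x y x' y'; exact: reduces_toL.
- move=> c; rewrite memv_cap => /andP[/hC[f [fG cf]] cS]; exists f => //.
  apply: minus_points_mem => // j Sj.
  by have := cf j; rewrite (coordsub_out cS Sj) rmorph0 subr0.
- move=> c f cf f0; apply/rowP => j; rewrite mxE.
  apply: (@const_vge1 (P j)); rewrite -[iota _]opprK; apply: vgeN.
  by have := cf j; rewrite f0 sub0r.
Qed.

(** Evaluation maps L(G) to [C] with kernel L(G - D). *)
Lemma ell_le_dim : (ell G <= \dim C + ell (minus_points predT))%N.
Proof.
have [Q Q1] := exists_rational_place.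
pose A := minus_points predT.
have [m [_ Em Am]] := rdim_rr_effE hff hg Q1 (points predT) A.
have GA R : coef (eff (points predT) ++ A) R = coef G R.
  by rewrite /A !divcoef_cat divcoef_scale; lia.
rewrite -(ell_ext GA) Em leq_add2r.
apply: (rdim_rel (R := fun f c => rr_space G f /\ reduces_to c f) _ _ _ _ _ Am (rdim_vspace C)).
- exact: subsp_zero.
- by split; [exact: subsp0 (subsp_rr G) | exact: reduces_to0].
- by move=> a x y x' y' [? ?] [? ?]; split; [exact: (subsp_rr G).2 | exact: reduces_toL].
- move=> f fA; have fG : rr_space G f by apply: rr_mono fA => R; rewrite GA.
  have /choice[c cP] : forall j, exists c : F, vge (P j) (f - iota c : Kmod iota) 1.
    move=> j; apply: residue_const => //.
    by have := fG (P j); rewrite hG oppr0.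
  exists (\row_j c j); last by split=> // j; rewrite mxE.
  by apply/hC; exists f; split=> // j; rewrite mxE.
- move=> f c [fG fc] c0; apply: minus_points_mem => // j _.
  by have := fc j; rewrite c0 mxE rmorph0 subr0.
Qed.

(** If deg G >= n, then l(G - D) <= deg G - n + 1, whence k >= n - g; with 2k <= n this gives n <=
    2g. *)
Lemma ddeg_lt_length : ddeg G < n%:Z.
Proof.
have [Q Q1] := exists_rational_place.
rewrite ltNge; apply/negP => nG.
have dA := ddeg_minus_points predT; rewrite card_ord in dA.
have := ell_le_deg hff hcf hg Q1 (A := minus_points predT).
have := riemann_inequality hg G; have := ell_le_dim; lia.
Qed.

(** Pad [A] to [B] of degree exactly 2g - 1 - gam. Index of speciality 2 or more would yield, by
    [special_pair], a divisor of degree at most gam - 1 with l >= 2; index at most 1 gives the bound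
    for [B], hence for [A]. *)
Lemma ell_special_le (A : divisor iota) : ddeg A <= 2 * g%:Z - 1 - gam -> (ell A)%:Z <= g%:Z - gam + 1.
Proof.
have [Q Q1] := exists_rational_place => dA.
pose m := `|(2 * g%:Z - 1 - gam - ddeg A)%R|%N.
pose B := eff (nseq m Q) ++ A.
have dB : ddeg B = 2 * g%:Z - 1 - gam.
  by rewrite ddeg_cat ddeg_eff deg_eff_nseq // /m; lia.
have sB : (spec g B <= 1)%N.
  rewrite leqNgt; apply/negP => /(special_pair hff hcf hg Q1)[E E2 dE].
  by have := hgam.2 E E2; lia.
have := specE hg B; have := ell_eff_ge hff hg Q1 (nseq m Q) A.
rewrite -/B; lia.
Qed.

(** Riemann's inequality gives l((g + 1) Q) >= 2. *)
Lemma gonality_le : gam <= g%:Z + 1.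
Proof.
have [Q Q1] := exists_rational_place.
pose B := eff (nseq g.+1 Q).
have dB : ddeg B = g.+1%:Z by rewrite ddeg_eff deg_eff_nseq.
have := hgam.2 B; have := riemann_inequality hg B; lia.
Qed.

(* Cut at the first i where the points P_0, ..., P_(i-1) impose enough conditions to bring
   l(G - P_0 - ... - P_(i-1)) down to at most 1. *)
Lemma exists_small_Delta : exists2 i, (i <= n)%N & (Delta C i)%:Z <= g%:Z + 2 - gam.
Proof.
have [Q Q1] := exists_rational_place.
have dG := ddeg_lt_length; have gamg := gonality_le.
pose S i : pred 'I_n := fun j => (j < i)%N.
have cardS i : (i <= n)%N -> #|S i| = i.
  move=> lin; rewrite -sum1_card (eq_bigl (fun j : 'I_n => (j < i)%N)) //.
  by rewrite (big_ord_narrow lin) sum1_card card_ord.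
have cardSC i : (i <= n)%N -> #|predC (S i)| = (n - i)%N.
  move=> lin; have := cardC (S i); rewrite cardS // card_ord => E.
  by rewrite -[X in (X - i)%N]E addKn.
have ellT : ell (minus_points predT) = 0%N.
  by apply: (ell_neg hcf hg Q1); rewrite ddeg_minus_points card_ord; lia.
pose b i := ell (minus_points (S i)).
have DeltaE i : (Delta C i <= ell (minus_points (predC (S i))) + b i)%N.
  apply: leq_add; first exact: dim_subcode_le.
  apply: leq_trans (dim_subcode_le _) _.
  suff -> : minus_points (predC (fun j : 'I_n => (i <= j)%N)) = minus_points (S i) by [].
  rewrite /minus_points /points; congr (_ ++ _); congr dscale; congr eff; congr map.
  by apply: eq_enum => j; rewrite !inE /= -ltnNge.
have b_n : b n = 0%N.
  rewrite /b -ellT; apply: ell_ext => R; rewrite /minus_points /points.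
  suff -> : enum (S n) = enum predT by [].
  by apply: eq_enum => j; exact: ltn_ord.
have exi : exists i, (b i <= 1)%N by exists n; rewrite b_n.
case: (ex_minnP exi) => i bi imin.
have lin : (i <= n)%N by apply: imin; rewrite b_n.
exists i => //; have := DeltaE i.
case: i => [|i] in bi imin lin *.
  (* For a cut at 0 one term is zero, its divisor having degree deg G - n < 0, and the other is at
     most 1 <= g + 2 - gam by [gonality_le]. *)
  have -> : ell (minus_points (predC (S 0%N))) = 0%N.
    by apply: (ell_neg hcf hg Q1); rewrite ddeg_minus_points cardSC //; lia.
  lia.
(* Minimality of the cut leaves l >= 2 one point earlier, so gam <= deg G - i. *)
have bi1 : (2 <= b i)%N by rewrite ltnNge; apply/negP => /imin; rewrite ltnn.
have := hgam.2 _ bi1; rewrite ddeg_minus_points cardS ?(ltnW lin) // => dS.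
(* As l(G - D) = 0, deg G + 1 - g <= k <= n / 2, so 2 deg G - n <= 2g - 2. With gam <= deg G - i
   this gives deg G - (n - i - 1) <= 2g - 1 - gam. *)
have := ell_le_dim; have := riemann_inequality hg G; rewrite ellT => rG kG.
have := @ell_special_le (minus_points (predC (S i.+1))).
rewrite ddeg_minus_points cardSC //; lia.
Qed.

Lemma state_cx_lower_bound : (\dim C)%:Z - g%:Z + gam - 2 <= (state_cx C)%:Z.
Proof.
have [i lin Di] := exists_small_Delta.
apply: (@le_trans _ _ (\dim C - Delta C i)%N%:Z); first by lia.
by rewrite lez_nat; exact: state_cx_ge.
Qed.

End GoppaCodes.

Theorem theorem3p12 (F : finFieldType) (K : fieldType)
  (iota : {rmorphism F -> K})
  (hff : function_field iota) (hcf : full_constant_field iota)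
  (g : nat) (hg : is_genus iota g)
  (gamma2 : int) (hgam : is_gonality iota gamma2)
  (n : nat) (P : 'I_n -> place iota)
  (hPinj : injective P) (hPrat : forall i, pdeg (P i) = 1%N)
  (G : divisor iota) (hG : forall i, coef G (P i) = 0)
  (C : {vspace 'rV[F]_n})
  (hC : forall c : 'rV[F]_n, c \in C <->
          exists f : K, inL G f /\
            forall i : 'I_n, vge (P i) (f - iota (c 0 i)) 1)
  (hkn : (2 * \dim C <= n)%N) (hng : (2 * g < n)%N) :
  (wcode C)%:Z - g%:Z + gamma2 - 2 <= (perm_state_cx C)%:Z.
Proof.
have wk : (wcode C <= \dim C)%N by exact: geq_minl.
apply: le_trans (_ : (\dim C)%:Z - g%:Z + gamma2 - 2 <= _); first by lia.
rewrite /perm_state_cx.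
(* The initial value of the minimum is the unpermuted code, to which the bound applies as well. *)
apply: (big_ind (fun m : nat => (\dim C)%:Z - g%:Z + gamma2 - 2 <= m%:Z)).
- exact: (state_cx_lower_bound hff hcf hg hgam hPinj hPrat hG hC hkn hng).
- by move=> x y xk yk; rewrite /minn; case: ifP.
move=> s _; rewrite -(dim_permcode s C).
(* The permuted code is the code of the same [G] at the points in the order [P \o s^-1], so the
   bound for a fixed order covers every order. *)
apply: (@state_cx_lower_bound _ _ _ hff hcf _ hg _ hgam _ (P \o s^-1%g) _ _ G) => //=.
- by move=> i j /hPinj/perm_inj.
- move=> c; rewrite mem_permcode hC; split=> -[f [fG fc]]; exists f; split=> // i.
    by have := fc (s^-1%g i); rewrite mxE permKV.
  by have := fc (s i); rewrite /= permK mxE.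
- by rewrite dim_permcode.
Qed.
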